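(* Let $X_1,\dots,X_n$ be independent realizations of a $d$-dimensional random vector $X\sim P$. Assume that $P$ is spherically symmetric and that the sequence of scores $\{a(i)\}_{1\le i\le n}$ satisfies $$\sum_{i=1}^n a^2(i)\to\infty\quad\text{and}\quad \max_{1\le i\le n}\frac{a^2(i)}{\sum_{j=1}^n a^2(j)}\to0\quad\text{as } n\to\infty.$$ Then, as $n$ and $d$ both grow to infinity, the linear rank statistic $T_{LR}$ satisfies $$\frac{T_{LR}-\frac12\sum_{i=1}^n a(i)}{\sqrt{\sum_{i=1}^n a^2(i)}}\ \stackrel{D}{\to}\ \mathcal{N}\left(0,\tfrac14\right).$$
   Context: Here $d\ge 2$, $n\ge2$; $P$ may depend on $d$, and $n,d$ tend to infinity simultaneously at arbitrary rates. A random vector $X$ in $\mathbb{R}^d$ (or its distribution) is spherically symmetric (about the origin) if $HX\stackrel{D}{=}X$ for every $d\times d$ orthogonal matrix $H$. The spherically symmetric variants of $X_1,\dots,X_n$ are $X_i'=\|X_i\|U_i$, where $U_1,\dots,U_n$ are i.i.d. uniform on the unit sphere $\mathcal{S}^{d-1}$, independent of $(X_1,\dots,X_n)$. For $x,y\in\mathbb{R}^d$ put $\theta(x,y)=\exp\{-(\frac1d x^\top y)^2\}$. For $s\in\{0,1\}$ let $Y_{s,i}=sX_i+(1-s)X_i'$. Let $\mathcal{S}_n$ be the set of permutations of $\{1,\dots,n\}$. Define $$(S,\Pi)=\arg\min_{s\in\{0,1\}^n,\ \pi\in\mathcal{S}_n}\ \sum_{i=1}^{n-1}\theta\big(Y_{s_{\pi_i},\pi_i},Y_{s_{\pi_{i+1}},\pi_{i+1}}\big),$$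 with $S=(S_1,\dots,S_n)$ and $\Pi=(\pi_1,\dots,\pi_n)$. A path and its reversal have equal cost; when there are several minimizers one of them is chosen uniformly at random, independently of everything else. The linear rank statistic with real scores $a(i)$ is $T_{LR}=\sum_{i=1}^n S_{\pi_i}a(i)$. *)

(* Defs.v *)
From HB Require Import structures.
From mathcomp Require Import all_boot all_order all_algebra all_fingroup.
From mathcomp Require Import all_classical all_reals all_analysis.

Set Implicit Arguments.
Unset Strict Implicit.
Unset Printing Implicit Defensive.
Import Order.TTheory GRing.Theory Num.Theory.
Import numFieldNormedType.Exports.

Local Open Scope classical_set_scope.
Local Open Scope ring_scope.

(* Vectors of R^d are [d.-tuple R], on which the library puts the product
   (that is, Borel) sigma-algebra.  All indices start at 0. *)

Section euclidean.
Context {R : realType} {d : nat}.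
Implicit Types x y : d.-tuple R.

Definition dot x y : R := \sum_(i < d) tnth x i * tnth y i.

Definition enorm x : R := Num.sqrt (dot x x).

Definition tscale (c : R) x : d.-tuple R := [tuple c * tnth x i | i < d].

Definition lin_act (H : 'M[R]_d) x : d.-tuple R :=
  [tuple \sum_(j < d) H i j * tnth x j | i < d].

Definition orthogonal_mx (H : 'M[R]_d) : Prop := H *m H^T = 1%:M.

Definition spherically_symmetric (P : probability (d.-tuple R) R) : Prop :=
  forall H : 'M[R]_d, orthogonal_mx H ->
  forall A : set (d.-tuple R), measurable A -> P (lin_act H @^-1` A) = P A.

(* The uniform distribution on the unit sphere is the (unique) probability
   measure carried by the sphere that is invariant under the orthogonal
   group. *)
Definition uniform_on_sphere (Q : probability (d.-tuple R) R) : Prop :=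
  Q [set x | enorm x = 1] = 1%E /\ spherically_symmetric Q.

Definition theta x y : R := expR (- (d%:R^-1 * dot x y) ^+ 2).

End euclidean.

Section probability.
Context {R : realType} {disp : measure_display} {Omega : measurableType disp}.
Variable Pr : probability Omega R.

(* Mutual independence; finite subfamilies are covered by taking some of the
   [B i] equal to [setT]. *)
Definition mutually_independent {disp'} {T : measurableType disp'}
    (I : finType) (X : I -> {RV Pr >-> T}) : Prop :=
  forall B : I -> set T, (forall i, measurable (B i)) ->
    Pr [set w | forall i, B i (X i w)] = (\prod_(i : I) Pr (X i @^-1` B i))%E.

Definition has_law {disp'} {T : measurableType disp'}
    (X : {RV Pr >-> T}) (P : probability T R) : Prop :=
  forall A : set T, measurable A -> distribution Pr X A = P A.

Definition joint {T : Type} {n : nat} (X : 'I_n -> Omega -> T) (w : Omega) :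
  n.-tuple T := [tuple X i w | i < n].

Definition independent_families {disp'} {T : measurableType disp'} {n : nat}
    (X U : 'I_n -> {RV Pr >-> T}) : Prop :=
  forall A B : set (n.-tuple T), measurable A -> measurable B ->
    Pr (joint X @^-1` A `&` joint U @^-1` B) =
    (Pr (joint X @^-1` A) * Pr (joint U @^-1` B))%E.

End probability.

(* A pair (s, pi) with s in {0,1}^n and pi a permutation of the indices. *)
Definition labelled_path (n : nat) : finType := ({ffun 'I_n -> bool} * 'S_n)%type.

Section shortest_path.
Context {R : realType} {n d : nat}.

(* [Y s i] is [X_i] if [s i] and [X'_i = |X_i| U_i] otherwise, where [x] and
   [u] are the observed samples of the [X_i] and of the [U_i]. *)
Definition spherical_variant (x u : n.-tuple (d.-tuple R)) (i : 'I_n) :=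
  tscale (enorm (tnth x i)) (tnth u i).

Definition Yvec (x u : n.-tuple (d.-tuple R)) (s : bool) (i : 'I_n) :=
  if s then tnth x i else spherical_variant x u i.

Definition path_cost (x u : n.-tuple (d.-tuple R)) (c : labelled_path n) : R :=
  let Y i := Yvec x u (c.1 (c.2 i)) (c.2 i) in
  \sum_(i < n) \sum_(j < n | j == i.+1 :> nat) theta (Y i) (Y j).

Definition minimizers (x u : n.-tuple (d.-tuple R)) : {set labelled_path n} :=
  [set c : labelled_path n | [forall c', path_cost x u c <= path_cost x u c']].

Definition linear_rank_statistic (a : 'I_n -> R) (c : labelled_path n) : R :=
  \sum_(i < n) (c.1 (c.2 i))%:R * a i.

(* [C] is a minimizer chosen uniformly at random, independently of everything
   else: on the event that the set of minimizers is [M], conditionally on the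
   sigma-algebra generated by [X] and [U], [C] is uniform on [M]. *)
Definition uniform_minimizer {disp : measure_display}
    {Omega : measurableType disp} (Pr : probability Omega R)
    (X U : 'I_n -> {RV Pr >-> d.-tuple R}) (C : Omega -> labelled_path n) :
    Prop :=
  let argmin w := minimizers (joint X w) (joint U w) in
  [/\ (forall c, measurable (C @^-1` [set c])),
      (forall w, C w \in argmin w) &
      forall (M : {set labelled_path n}) (c : labelled_path n)
        (A : set (n.-tuple (d.-tuple R) * n.-tuple (d.-tuple R))),
        measurable A ->
        let E := [set w | A (joint X w, joint U w) /\ argmin w = M] in
        Pr (E `&` C @^-1` [set c]) =
        ((if c \in M then #|M|%:R^-1 else 0)%:E * Pr E)%E].

End shortest_path.

(* Convergence in distribution of real random variables (possibly defined on
   different probability spaces) to the law [mu]: convergence of the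
   distribution functions at the continuity points of that of [mu]. *)
Definition cvg_in_distribution {R : realType} {disp : nat -> measure_display}
    {Omega : forall k, measurableType (disp k)}
    (Pr : forall k, probability (Omega k) R) (T : forall k, Omega k -> R)
    (mu : set R -> \bar R) : Prop :=
  forall x : R, {for x, continuous (fun y : R => mu `]-oo, y]%classic)} ->
    Pr k [set w | T k w <= x] @[k --> \oo] --> mu `]-oo, x]%classic.

(* Main.v *)
Require Import Defs.
From HB Require Import structures.
From mathcomp Require Import all_boot all_order all_algebra all_fingroup.
From mathcomp Require Import all_classical all_reals all_analysis.
From mathcomp Require Import measurable_realfun ring lra.

Set Implicit Arguments.
Unset Strict Implicit.
Unset Printing Implicit Defensive.
Import Order.TTheory GRing.Theory Num.Theory.
Import numFieldNormedType.Exports.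

Local Open Scope classical_set_scope.
Local Open Scope ring_scope.

(* Write X_i = |X_i| V_i.  By spherical symmetry V_i is uniform on the sphere and
   independent of |X_i|, so exchanging X_i and X'_i = |X_i| U_i amounts to
   exchanging the i.i.d. directions V_i and U_i and preserves the law of the data,
   while it flips the i-th label in every minimizer.  Hence, given Pi, the labels S
   are uniform on {0,1}^n, the labels read along the path are i.i.d. fair bits, and
   T_LR is distributed as a weighted sum of fair bits.

   That V_i is uniform on the sphere rests on the uniqueness of the rotation
   invariant probability measure, obtained by Christensen's argument: balls of a
   given radius have the same mass everywhere, and counting pairs of points at
   distance < r in two ways by Fubini compares two invariant measures.

   The central limit theorem for the signs is Lindeberg's replacement scheme run
   along the heat flow of the normal distribution function, which is explicit. *)

(** * Generating families of product sigma-algebras *)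

(** Two degeneracies shape the exchange argument. [P] may charge the origin, where no direction
    exists; but there X_i and X'_i are both 0, so the set of minimizers is already invariant under
    the flip of the i-th label, and the exchange is carried out only where X_i is nonzero.
    Minimizers are moreover never unique, since a path and its reversal have equal cost. The
    argument therefore follows the whole set of minimizers: the flip is a bijection of labelled
    paths, so it preserves the size of this set, and a uniform choice in it inherits the symmetry.

    The resulting law of the labels is exact for each k, and there remains a limit theorem for signs
    with deterministic weights that change with k. Hence the central limit theorem takes the form of
    an estimate uniform over all weights with unit sum of squares and small maximum. The indicator
    of a half-line is handled by adding a little Gaussian noise, so that the smooth test functions
    are themselves normal distribution functions. *)

Lemma measure_pi_unique d (T : measurableType d) (R : realType)
    (G : set (set T)) (m1 m2 : {measure set T -> \bar R}) :
  measurable = <<s G >> -> setI_closed G -> G setT -> (m1 setT < +oo)%E ->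
  (forall A, G A -> m1 A = m2 A) -> forall A, measurable A -> m1 A = m2 A.
Proof.
move=> mG IG GT m1T eqG A mA.
apply: (measure_unique G (fun=> setT)) => //.
by rewrite bigcup_const//; exists 0%N.
Qed.

Definition boxes T n (C : set (set T)) : set (set (n.-tuple T)) :=
  [set A | exists2 B : 'I_n -> set T, (forall i, C (B i)) &
    A = [set t | forall i, B i (tnth t i)]].

Lemma boxes_setI_closed T n (C : set (set T)) :
  setI_closed C -> setI_closed (@boxes T n C).
Proof.
move=> CI _ _ [B1 CB1 ->] [B2 CB2 ->].
exists (fun i => B1 i `&` B2 i); first by move=> i; exact: CI.
rewrite predeqE => t; split => [[h1 h2] i|h]; first by split.
by split => i; have [] := h i.
Qed.

Lemma boxes_setT T n (C : set (set T)) : C setT -> @boxes T n C setT.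
Proof. by move=> CT; exists (fun=> setT) => //; rewrite predeqE. Qed.

Lemma measurable_box d (T : measurableType d) n (B : 'I_n -> set T) :
  (forall i, measurable (B i)) ->
  measurable [set t : n.-tuple T | forall i, B i (tnth t i)].
Proof.
move=> mB.
rewrite (_ : [set _ | _] = \big[setI/setT]_(i < n) ((@tnth _ T ^~ i) @^-1` B i)).
  apply: bigsetI_measurable => i _; rewrite -[X in measurable X]setTI.
  exact: measurable_tnth.
rewrite -bigcap_seq predeqE => t; split => [h i _|h i]; first exact: h.
by apply: (h i); rewrite /= mem_index_enum.
Qed.

Lemma measurable_tuple_boxes d (T : measurableType d) n (C : set (set T)) :
  measurable = <<s C >> -> C setT ->
  measurable = <<s @boxes T n C >>.
Proof.
move=> mC CT; rewrite eqEsubset; split; last first.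
  apply: smallest_sub; first exact: sigma_algebra_measurable.
  move=> _ [B CB ->]; apply: measurable_box => i.
  by rewrite mC; apply: sub_sigma_algebra.
apply: smallest_sub; first exact: smallest_sigma_algebra.
rewrite -bigcup_seq => _ [i _ [A mA <-]].
move: mA; rewrite mC => mA.
have : preimage_set_system setT (@tnth n T ^~ i) <<s C>> `<=` <<s @boxes T n C >>.
  rewrite -g_sigma_preimageE.
  apply: smallest_sub; first exact: smallest_sigma_algebra.
  move=> _ [D CD <-]; apply: sub_sigma_algebra.
  (* A constraint on the single coordinate [i] is a box because [C] contains [setT]. *)
  exists (fun j => if j == i then D else setT) => [j|]; first by case: ifP.
  rewrite setTI predeqE => t; split => [h j|/(_ i)]; last by rewrite eqxx.
  by case: eqP => // ->.
by apply; exists A.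
Qed.

(** The extended bound [b] brings in [setT]. Half-lines are used because their translates by
    -1/(k+1) increase to them, which gives boxes an approximation from inside that leaves room for
    caps of small radius. *)
Definition lower_rays (R : realType) : set (set R) :=
  [set A | exists b : \bar R, A = [set x | (x%:E < b)%E]].

Lemma lower_rays_setT (R : realType) : @lower_rays R setT.
Proof. by exists +oo%E; rewrite predeqE => x; rewrite /= ltry. Qed.

Lemma lower_rays_setI_closed (R : realType) : setI_closed (@lower_rays R).
Proof.
move=> _ _ [a ->] [b ->]; exists (Order.min a b).
by rewrite predeqE => x /=; rewrite lt_min; split => [[-> ->]|/andP].
Qed.

Lemma measurable_lower_rays (R : realType) :
  (measurable : set (set R)) = <<s @lower_rays R >>.
Proof.
rewrite eqEsubset; split.
  rewrite [X in X `<=` _](_ : _ = (@RGenInftyO.G R).-sigma.-measurable); last first.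
    by rewrite -RGenInftyO.measurableE.
  apply: smallest_sub; first exact: smallest_sigma_algebra.
  move=> _ [x ->]; apply: sub_sigma_algebra; exists x%:E.
  by rewrite predeqE => y /=; rewrite in_itv /= lte_fin.
apply: smallest_sub; first exact: sigma_algebra_measurable.
move=> _ [b ->]; case: b => [b| |].
- rewrite (_ : [set _ | _] = `]-oo, b[%classic); first exact: measurable_itv.
  by rewrite predeqE => y /=; rewrite in_itv /= lte_fin.
- rewrite (_ : [set _ | _] = setT); first exact: measurableT.
  by rewrite predeqE => x; rewrite /= ltry.
- rewrite (_ : [set _ | _] = set0); first exact: measurable0.
  by rewrite predeqE => x /=; split.
Qed.

(** * Rotations of the Euclidean space *)

Section rotations.
Context {R : realType} {d : nat}.
Implicit Types (x y z : d.-tuple R) (H : 'M[R]_d).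

Let cv x : 'cV[R]_d := \col_i tnth x i.

Lemma dotE x y : dot x y = ((cv x)^T *m cv y) 0 0.
Proof. by rewrite !mxE; apply: eq_bigr => i _; rewrite !mxE. Qed.

Lemma dotC x y : dot x y = dot y x.
Proof. by apply: eq_bigr => i _; rewrite mulrC. Qed.

Lemma cv_lin_act H x : cv (lin_act H x) = H *m cv x.
Proof.
apply/colP => i; rewrite !mxE tnth_mktuple.
by apply: eq_bigr => j _; rewrite !mxE.
Qed.

Lemma cv_inj : injective cv.
Proof. by move=> x y /colP h; apply: eq_from_tnth => i; have := h i; rewrite !mxE. Qed.

Lemma lin_act1 x : lin_act 1%:M x = x.
Proof. by apply: cv_inj; rewrite cv_lin_act mul1mx. Qed.

Lemma orthogonal_mxTl H : orthogonal_mx H -> H^T *m H = 1%:M.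
Proof. exact: mulmx1C. Qed.

Lemma dot_lin_act H x y : orthogonal_mx H ->
  dot (lin_act H x) (lin_act H y) = dot x y.
Proof.
move=> oH; rewrite !dotE !cv_lin_act trmx_mul mulmxA -(mulmxA _ _ H).
by rewrite orthogonal_mxTl// mulmx1.
Qed.

Lemma enorm_lin_act H x : orthogonal_mx H -> enorm (lin_act H x) = enorm x.
Proof. by move=> oH; rewrite /enorm dot_lin_act. Qed.

Lemma dot_ge0 x : 0 <= dot x x.
Proof. by apply: sumr_ge0 => i _; rewrite -expr2 sqr_ge0. Qed.

Lemma dot_eq0 x : (dot x x == 0) = (x == [tuple 0 | _ < d]).
Proof.
rewrite /dot psumr_eq0; last by move=> i _; rewrite -expr2 sqr_ge0.
apply/allP/eqP => [h|-> i _]; last by rewrite tnth_mktuple mulr0 eqxx.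
apply: eq_from_tnth => i; rewrite tnth_mktuple; apply/eqP.
by have := h i (mem_index_enum _); rewrite /= -expr2 sqrf_eq0.
Qed.

Lemma enorm_ge0 x : 0 <= enorm x. Proof. exact: sqrtr_ge0. Qed.

Lemma enorm_sqr x : enorm x ^+ 2 = dot x x.
Proof. by rewrite sqr_sqrtr// dot_ge0. Qed.

Lemma enorm_eq0 x : (enorm x == 0) = (x == [tuple 0 | _ < d]).
Proof. by rewrite -dot_eq0 -enorm_sqr sqrf_eq0. Qed.

Lemma dotZZ (a b : R) x y : dot (tscale a x) (tscale b y) = a * b * dot x y.
Proof.
by rewrite /dot mulr_sumr; apply: eq_bigr => i _; rewrite !tnth_mktuple; ring.
Qed.

Lemma enorm_tscale (a : R) x : enorm (tscale a x) = `|a| * enorm x.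
Proof. by rewrite /enorm dotZZ -expr2 sqrtrM ?sqr_ge0// sqrtr_sqr. Qed.

Lemma tscaleA (a b : R) x : tscale a (tscale b x) = tscale (a * b) x.
Proof. by apply: eq_from_tnth => i; rewrite !tnth_mktuple mulrA. Qed.

Lemma tscale1 x : tscale 1 x = x.
Proof. by apply: eq_from_tnth => i; rewrite !tnth_mktuple mul1r. Qed.

Lemma lin_act_tscale H (a : R) x : lin_act H (tscale a x) = tscale a (lin_act H x).
Proof.
apply: eq_from_tnth => i; rewrite !tnth_mktuple mulr_sumr.
by apply: eq_bigr => j _; rewrite tnth_mktuple mulrCA.
Qed.

Definition sqdist x y : R := \sum_(i < d) (tnth x i - tnth y i) ^+ 2.

Lemma sqdistE x y : sqdist x y = dot x x - dot x y *+ 2 + dot y y.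
Proof.
rewrite /sqdist /dot -sumrMnl -sumrB -big_split /=.
by apply: eq_bigr => i _; rewrite sqrrB !expr2.
Qed.

Lemma sqdistC x y : sqdist x y = sqdist y x.
Proof. by apply: eq_bigr => i _; rewrite -opprB sqrrN. Qed.

Lemma sqdist_lin_act H x y : orthogonal_mx H ->
  sqdist (lin_act H x) (lin_act H y) = sqdist x y.
Proof. by move=> oH; rewrite !sqdistE !dot_lin_act. Qed.

Lemma ler_coord_sqdist x y (r : R) i : 0 <= r -> sqdist x y < r ^+ 2 ->
  `|tnth x i - tnth y i| < r.
Proof.
move=> r0 xy; rewrite -(ltr_pXn2r (ltn0Sn 1)) ?nnegrE// real_normK ?num_real//.
apply: le_lt_trans xy; rewrite /sqdist (bigD1 i)//= lerDl.
by apply: sumr_ge0 => j _; rewrite sqr_ge0.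
Qed.

(* The Householder reflection exchanging [x] and [y]. *)
Lemma orthogonal_transitive x y : enorm x = 1 -> enorm y = 1 ->
  exists2 H, orthogonal_mx H & lin_act H x = y.
Proof.
move=> x1 y1; have [->|xy] := eqVneq x y.
  by exists 1%:M; rewrite ?lin_act1// /orthogonal_mx trmx1 mulmx1.
have dx : dot x x = 1 by rewrite -enorm_sqr x1 expr1n.
have dy : dot y y = 1 by rewrite -enorm_sqr y1 expr1n.
pose w : 'cV[R]_d := cv x - cv y.
have xyE : (cv x)^T *m cv y = (dot x y)%:M.
  by rewrite [LHS]mx11_scalar -dotE.
have yxE : (cv y)^T *m cv x = (dot x y)%:M.
  by rewrite [LHS]mx11_scalar -dotE dotC.
have xxE : (cv x)^T *m cv x = 1%:M by rewrite [LHS]mx11_scalar -dotE dx.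
have yyE : (cv y)^T *m cv y = 1%:M by rewrite [LHS]mx11_scalar -dotE dy.
have wxE : w^T *m cv x = (1 - dot x y)%:M.
  by rewrite /w linearB /= mulmxBl xxE yxE -raddfB.
have wwE : w^T *m w = ((1 - dot x y) *+ 2)%:M.
  have wyE : w^T *m cv y = (dot x y - 1)%:M.
    by rewrite /w linearB /= mulmxBl xyE yyE -raddfB.
  by rewrite {2}/w mulmxBr wxE wyE -raddfB; congr (_%:M); ring.
have t0 : 1 - dot x y != 0.
  apply: contra_neq xy => t0; have : sqdist x y = 0.
    by rewrite sqdistE dx dy -[RHS](mul0rn _ 2) -t0; ring.
  move=> /eqP; rewrite psumr_eq0; last by move=> i _; rewrite sqr_ge0.
  move=> /allP h; apply: eq_from_tnth => i; apply/eqP.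
  by have := h i (mem_index_enum _); rewrite /= sqrf_eq0 subr_eq0.
(* The usual factor 2 / |w|^2, as |w|^2 = 2 (1 - dot x y) for unit vectors. *)
pose c := (1 - dot x y)^-1.
pose H := 1%:M - c *: (w *m w^T).
have HT : H^T = H by rewrite /H linearB /= linearZ /= trmx1 trmx_mul trmxK.
exists H.
  have MM : (w *m w^T) *m (w *m w^T) = ((1 - dot x y) *+ 2) *: (w *m w^T).
    by rewrite mulmxA -(mulmxA w) wwE mul_mx_scalar scalemxAl.
  rewrite /orthogonal_mx HT /H mulmxBl mul1mx mulmxBr mulmx1 -scalemxAl -scalemxAr.
  rewrite MM !scalerA.
  have -> : c * c * ((1 - dot x y) *+ 2) = c *+ 2.
    by rewrite mulrnAr -mulrA mulVf// mulr1.
  by rewrite mulr2n scalerDl opprB addrK subrK.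
apply: cv_inj; rewrite cv_lin_act mulmxBl mul1mx -scalemxAl -mulmxA wxE.
by rewrite mul_mx_scalar scalerA mulVf// scale1r /w opprB addrC subrK.
Qed.

End rotations.

(** * Uniqueness of the rotation invariant measure on the sphere *)

Section measurability.
Context {R : realType} {d : nat}.
Context {disp : measure_display} {T : measurableType disp}.
Implicit Types (f g : T -> d.-tuple R) (c : T -> R).

Lemma measurable_coord f i :
  measurable_fun setT f -> measurable_fun setT (fun t => tnth (f t) i).
Proof. by move=> /measurable_fun_tnthP /(_ i). Qed.

Lemma measurable_dot f g : measurable_fun setT f -> measurable_fun setT g ->
  measurable_fun setT (fun t => dot (f t) (g t)).
Proof.
move=> mf mg; rewrite /dot.
apply: (@measurable_sum _ _ _ setT _ _ (fun i t => tnth (f t) i * tnth (g t) i)).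
by move=> i; apply: measurable_funM; exact: measurable_coord.
Qed.

Lemma measurable_sqdist f g : measurable_fun setT f -> measurable_fun setT g ->
  measurable_fun setT (fun t => sqdist (f t) (g t)).
Proof.
move=> mf mg; rewrite /sqdist.
apply: (@measurable_sum _ _ _ setT _ _ (fun i t => (tnth (f t) i - tnth (g t) i) ^+ 2)).
by move=> i; apply: measurable_funX; apply: measurable_funB; exact: measurable_coord.
Qed.

Lemma measurable_enorm f :
  measurable_fun setT f -> measurable_fun setT (fun t => enorm (f t)).
Proof.
move=> mf; apply: (measurableT_comp (f := @Num.sqrt R)); last exact: measurable_dot.
by apply: continuous_measurable_fun; exact: sqrt_continuous.
Qed.

Lemma measurable_tscale c f : measurable_fun setT c -> measurable_fun setT f ->
  measurable_fun setT (fun t => tscale (c t) (f t)).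
Proof.
move=> mc mf; apply/measurable_fun_tnthP => i.
rewrite (_ : _ \o _ = fun t => c t * tnth (f t) i); last first.
  by apply/funext => t /=; rewrite tnth_mktuple.
by apply: measurable_funM => //; exact: measurable_coord.
Qed.

Lemma measurable_preimageT disp' (T' : measurableType disp') (f : T -> T') A :
  measurable_fun setT f -> measurable A -> measurable (f @^-1` A).
Proof. by move=> mf mA; rewrite -[X in measurable X]setTI; exact: mf. Qed.

Lemma measurable_set_ltr (f g : T -> R) : measurable_fun setT f ->
  measurable_fun setT g -> measurable [set t | f t < g t].
Proof.
move=> mf mg; rewrite (_ : [set _ | _] = (fun t => f t < g t) @^-1` [set true]).
  by apply: measurable_preimageT => //; exact: measurable_fun_ltr.
by rewrite predeqE.
Qed.

End measurability.

Definition usphere (R : realType) d : set (d.-tuple R) := [set x | enorm x = 1].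

(** A full Euclidean ball: the measures below charge only its trace on the sphere. *)
Definition cap (R : realType) d (r : R) (x : d.-tuple R) : set (d.-tuple R) :=
  [set y | sqdist x y < r ^+ 2].

(** Stated for arbitrary set functions, since one of the measures compared later is the image of a
    restriction of [P] and has mass possibly below 1. *)
Definition rotation_invariant (R : realType) d
    (m : set (d.-tuple R) -> \bar R) : Prop :=
  forall H : 'M[R]_d, orthogonal_mx H ->
  forall A : set (d.-tuple R), measurable A -> m (lin_act H @^-1` A) = m A.

Lemma measurable_usphere (R : realType) d : measurable (@usphere R d).
Proof.
rewrite (_ : @usphere R d = (@enorm R d) @^-1` [set 1])//.
apply: measurable_preimageT => //.
by apply: measurable_enorm; exact: measurable_id.
Qed.

Lemma measurable_cap (R : realType) d (r : R) (x : d.-tuple R) :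
  measurable (cap r x).
Proof.
apply: (measurable_set_ltr (f := fun y => sqdist x y) (g := cst (r ^+ 2))) => //.
by apply: measurable_sqdist.
Qed.

(** * Caps under one rotation invariant measure *)

Section invariant_measure.
Local Open Scope ereal_scope.
Context {R : realType} {d : nat}.
Implicit Types (x y z : d.-tuple R) (r : R).
Notation S := (@usphere R d).

Section one_measure.
Variable m : {measure set (d.-tuple R) -> \bar R}.
Hypotheses (m_inv : rotation_invariant m) (mS : m (~` S) = 0).

Lemma invariant_cap x y r : S x -> S y -> m (cap r x) = m (cap r y).
Proof.
move=> Sx Sy; have [H oH Hx] := orthogonal_transitive Sx Sy.
rewrite -(m_inv oH (measurable_cap r y)); congr (m _).
by rewrite predeqE => z; rewrite /cap /= -Hx sqdist_lin_act.
Qed.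

Lemma measure_setI_usphere A : measurable A -> m (A `&` S) = m A.
Proof.
move=> mA; have mS' := @measurable_usphere R d.
have AS0 : m (A `\` S) = 0.
  have sub : A `\` S `<=` ~` S by move=> x [].
  exact: (subset_measure0 (measurableD mA mS') (measurableC mS') sub mS).
by rewrite [RHS](measureDI m mA mS') [X in _ = X + _]AS0 add0e.
Qed.

(** If one cap of radius [r] were null, all would be, by transitivity of the rotations. A countable
    grid of cubes, each of whose traces on the sphere fits in such a cap, would then make the whole
    sphere null. *)
Lemma measure_cap_gt0 x r : m setT != 0 -> S x -> (0 < r)%R -> 0 < m (cap r x).
Proof.
move=> m0 Sx r0; rewrite lt_def measure_ge0 andbT; apply: contra_neq m0 => mx.
(* Two points of a cube of side [e] are at squared distance at most d e^2 = d r^2 / (d+1)^2, which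
   is strictly less than r^2. *)
pose e := (r / d.+1%:R)%R.
have e0 : (0 < e)%R by rewrite divr_gt0.
pose side (k : int) : set R := [set t | (k%:~R * e <= t < (k + 1)%:~R * e)%R].
have mside k : measurable (side k).
  rewrite (_ : side k = `[(k%:~R * e)%R, ((k + 1)%:~R * e)%R[%classic).
    exact: measurable_itv.
  by rewrite predeqE => t; rewrite /= in_itv.
pose cube (k : d.-tuple int) : set (d.-tuple R) :=
  [set y | forall i, side (tnth k i) (tnth y i)].
have mcube k : measurable (cube k).
  exact: (measurable_box (B := fun i => side (tnth k i))).
have cube0 k : m (cube k `&` S) = 0.
  have [[y [ky Sy]]|/set0P/negP/negPn/eqP ->] :=
    pselect ((cube k `&` S) !=set0); last by rewrite measure0.
  have sub : cube k `&` S `<=` cap r y.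
    move=> z [kz Sz]; rewrite /cap /= /sqdist.
    apply: (@le_lt_trans _ _ (\sum_(i < d) e ^+ 2)%R).
      apply: ler_sum => i _; rewrite -[leLHS]real_normK ?num_real//.
      rewrite ler_pXn2r ?nnegrE ?(ltW e0)//.
      have /andP[a1 a2] := ky i; have /andP[b1 b2] := kz i.
      move: a1 a2 b1 b2; rewrite intrD mulrDl mul1r => *.
      by rewrite ler_norml; apply/andP; split; lra.
    rewrite sumr_const card_ord /e exprMn -mulrnAr -[ltRHS]mulr1.
    rewrite ltr_pM2l ?exprn_gt0// -mulr_natl exprVn ltr_pdivrMr ?exprn_gt0//.
    by rewrite mul1r -natrX ltr_nat (leq_trans (ltnSn d))// leq_pmulr.
  have my : m (cap r y) = 0 by rewrite (invariant_cap r Sy Sx).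
  have mS' := @measurable_usphere R d.
  exact: (subset_measure0 (measurableI _ _ (mcube k) mS') (measurable_cap r y) sub my).
(* The cubes are indexed by integer tuples; their codes turn the cover into a sequence, with the
   empty set at integers that code nothing. *)
pose F (j : nat) := if unpickle j is Some k then cube k `&` S else set0.
have mF j : measurable (F j).
  rewrite /F; case: unpickle => // k.
  by apply: measurableI => //; exact: measurable_usphere.
apply/eqP; rewrite -measure_le0 -[leLHS](measure_setI_usphere measurableT).
apply: (@le_trans _ _ (\sum_(0 <= j <oo) m (F j))); last first.
  by rewrite eseries0// => j _ _; rewrite /F; case: unpickle => //; rewrite measure0.
apply: measure_sigma_subadditive => //.
  by rewrite setTI; exact: measurable_usphere.
move=> y [_ Sy]; pose k := [tuple Num.floor (tnth y i / e)%R | i < d].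
exists (pickle k) => //; rewrite /F pickleK; split => // i.
rewrite /side /= tnth_mktuple -ler_pdivlMr// -ltr_pdivrMr//; exact: floor_itv.
Qed.

End one_measure.
End invariant_measure.

(** * Comparison of two invariant measures through caps *)

Section two_invariant_measures.
Local Open Scope ereal_scope.
Context {R : realType} {d : nat}.
Implicit Types (x y z : d.-tuple R) (r : R).
Notation S := (@usphere R d).
Variables m1 m2 : {finite_measure set (d.-tuple R) -> \bar R}.
Hypotheses (m1_inv : rotation_invariant m1) (m1S : m1 (~` S) = 0).
Hypotheses (m2_inv : rotation_invariant m2) (m2S : m2 (~` S) = 0).

(* Both sides bound the mass, under the product measure, of the pairs (x, y) of
   points of the sphere with y in G at distance less than r from x. *)
Lemma cap_comparison x0 r (A G : set (d.-tuple R)) :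
  S x0 -> measurable A -> measurable G ->
  (forall x y, A x -> (sqdist x y < r ^+ 2)%R -> G y) ->
  m2 (cap r x0) * m1 A <= m1 (cap r x0) * m2 G.
Proof.
move=> Sx0 mA mG AG; have mS := @measurable_usphere R d.
pose D : set (d.-tuple R * d.-tuple R) :=
  (S `*` (S `&` G)) `&` [set p | (sqdist p.1 p.2 < r ^+ 2)%R].
have mD : measurable D.
  apply: measurableI; first by apply: measurableX => //; exact: measurableI.
  by apply: measurable_set_ltr => //; apply: measurable_sqdist.
have fub : \int[m1]_x m2 (xsection D x) = \int[m2]_y m1 (ysection D y).
  have := indic_fubini_tonelli m1 m2 mD.
  by rewrite indic_fubini_tonelli_FE// indic_fubini_tonelli_GE.
have <- : m1 (A `&` S) = m1 A by exact: measure_setI_usphere.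
have <- : m2 (G `&` S) = m2 G by exact: measure_setI_usphere.
have mAS : measurable (A `&` S) by exact: measurableI.
have mGS : measurable (G `&` S) by exact: measurableI.
rewrite -!integral_cst//.
apply: (@le_trans _ _ (\int[m1]_x m2 (xsection D x))).
  apply: (@le_trans _ _ (\int[m1]_(x in A `&` S) m2 (xsection D x))).
    apply: ge0_le_integral => //.
      by apply: measurable_funTS; exact: (measurable_fun_xsection m2 mD).
    move=> x [Ax Sx].
    rewrite /cst -(invariant_cap m2_inv r Sx Sx0).
    rewrite -(measure_setI_usphere m2S (measurable_cap r x)).
    apply: le_measure; rewrite ?inE.
    - by apply: measurableI => //; exact: measurable_cap.
    - exact: measurable_xsection.
    - move=> y [xy Sy]; apply/xsectionP; split => //; split => //=; split => //.
      exact: AG xy.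
  apply: ge0_subset_integral => //.
  exact: (measurable_fun_xsection m2 mD).
rewrite fub.
rewrite [leRHS]integral_mkcond.
apply: ge0_le_integral => //.
- exact: (measurable_fun_ysection m1 mD).
- apply/(measurable_restrictT _ _).1 => //.
move=> y _; rewrite patchE; case: ifPn => [|ny].
  rewrite inE => -[Gy Sy]; rewrite /cst -(invariant_cap m1_inv r Sy Sx0).
  apply: le_measure; rewrite ?inE.
  - exact: measurable_ysection.
  - exact: measurable_cap.
  - by move=> x /ysectionP[[_ _] /=]; rewrite sqdistC.
rewrite (_ : ysection D y = set0) ?measure0//.
rewrite -subset0 => x /ysectionP[[_ [Sy Gy]] _].
by move: ny; rewrite notin_setE; apply.
Qed.

End two_invariant_measures.

Section invariant_uniqueness.
Local Open Scope ereal_scope.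
Context {R : realType} {d : nat}.
Implicit Types (x y z : d.-tuple R) (r : R).
Notation S := (@usphere R d).

Lemma measurable_lower_ray (A : set R) : lower_rays A -> measurable A.
Proof. by move=> rA; rewrite measurable_lower_rays; apply: sub_sigma_algebra. Qed.

(** With c a small cap and G' the box [G] shrunk by the radius of c, the cap comparison gives m2(c)
    m1(G') <= m1(c) m2(G). The same comparison with the measures exchanged and both sets equal to
    [setT] gives m1(c) m2(setT) <= m2(c) m1(setT). Together they eliminate m1(c); m2(c) > 0 cancels,
    and G' increases to [G]. *)
Lemma invariant_box_le (m1 m2 : {finite_measure set (d.-tuple R) -> \bar R}) :
  rotation_invariant m1 -> m1 (~` S) = 0 ->
  rotation_invariant m2 -> m2 (~` S) = 0 ->
  forall G, boxes (@lower_rays R) G -> m1 G * m2 setT <= m2 G * m1 setT.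
Proof.
move=> m1_inv m1S m2_inv m2S G [B rB GE].
have mG : measurable G.
  by rewrite GE; apply: measurable_box => i; exact: measurable_lower_ray (rB i).
have [m20|m20] := eqVneq (m2 setT) 0.
  by rewrite m20 mule0 mule_ge0.
(* The sphere is empty when d = 0, but then [m2] vanishes, which is the case already treated. *)
have [x0 Sx0] : exists x0, S x0.
  apply/not_existsP => S0; move/eqP: m20; apply.
  by rewrite -m2S; congr (m2 _); rewrite predeqE => x; split=> // _; exact: S0.
have /choice[b Bb] : forall i, exists b : \bar R, B i = [set t | t%:E < b].
  by move=> i; exact: rB.
pose sray c i : set R := [set t | (t + c)%:E < b i].
have msray c i : measurable (sray c i).
  have : measurable (B i) by exact: measurable_lower_ray (rB i).
  rewrite Bb => mB; apply: (measurable_preimageT (f := fun t : R => (t + c)%R) _ mB).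
  by apply: measurable_funD => //; exact: measurable_cst.
pose rk k : R := (k.+1%:R^-1)%R.
pose sG (k : nat) := [set x : d.-tuple R | forall i, sray (rk k) i (tnth x i)].
have msG k : measurable (sG k).
  exact: (measurable_box (B := sray (rk k))).
have sGU : \bigcup_k sG k = G.
  rewrite eqEsubset; split => x.
    move=> [k _ xk]; rewrite GE => i; rewrite Bb /=.
    by apply: le_lt_trans (xk i); rewrite lee_fin lerDl /rk invr_ge0.
  rewrite GE => xB.
  have [k _ /(_ k (leqnn k)) xk] :
      \forall k \near \oo, forall i : 'I_d, sray (rk k) i (tnth x i).
    apply: filter_forall => i; move: (xB i); rewrite Bb /sray /=.
    case: (b i) => [c||]; last 2 first.
    - by move=> _; near=> k; rewrite ltry.
    - by rewrite ltNge leNye.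
    rewrite lte_fin -subr_gt0 => xc; near=> k.
    rewrite lte_fin -ltrBrDl.
    by near: k; exact: (near_infty_natSinv_lt (PosNum xc)).
  by exists k.
have sG_le k : m1 (sG k) * m2 setT <= m2 G * m1 setT.
  have r0 : (0 < rk k)%R by rewrite /rk invr_gt0.
  have cG : m2 (cap (rk k) x0) * m1 (sG k) <= m1 (cap (rk k) x0) * m2 G.
    apply: cap_comparison => // x y xk xy; rewrite GE => i; rewrite Bb /=.
    apply: lt_trans (xk i); rewrite lte_fin.
    by have := ler_coord_sqdist i (ltW r0) xy; rewrite ltr_norml; lra.
  have cT : m1 (cap (rk k) x0) * m2 setT <= m2 (cap (rk k) x0) * m1 setT.
    exact: cap_comparison.
  have mc := measurable_cap (rk k) x0.
  have : (0 < fine (m2 (cap (rk k) x0)))%R.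
    rewrite fine_gt0// ltey_eq fin_num_measure// andbT.
    by apply: (measure_cap_gt0 (m := m2)) => //.
  move: cG cT.
  rewrite -(fineK (fin_num_measure m1 _ mc)) -(fineK (fin_num_measure m2 _ mc)).
  rewrite -(fineK (fin_num_measure m1 _ (msG k))) -(fineK (fin_num_measure m2 _ mG)).
  rewrite -(fineK (fin_num_measure m1 _ measurableT)).
  rewrite -(fineK (fin_num_measure m2 _ measurableT)).
  have : (0 <= fine (m2 setT))%R by exact: fine_ge0.
  have : (0 <= fine (m2 G))%R by exact: fine_ge0.
  rewrite -!EFinM !lee_fin.
  move: (fine _) (fine _) (fine _) (fine _) (fine _) (fine _) => t1 h1 g1 h2 t2 g2.
  move=> g20 t20 cG cT /= h20; rewrite -(ler_pM2l h20).
  have := ler_wpM2r t20 cG; have := ler_wpM2r g20 cT; lra.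
have sGcvg : m1 (sG k) @[k --> \oo] --> m1 G.
  rewrite -sGU; apply: nondecreasing_cvg_mu => //.
    by apply: bigcupT_measurable.
  move=> k l kl; apply/subsetPset => x xk i; apply: le_lt_trans (xk i).
  by rewrite lee_fin lerD2l lef_pV2 ?posrE// ler_nat.
have fin2 := fin_num_measure m2 _ measurableT.
apply: cvge_to_le (cvgeZr fin2 sGcvg) _.
by near=> k; exact: sG_le.
Unshelve. all: by end_near. Qed.

(** Cross-multiplied so as to cover total masses equal to 0. Each side is a multiple of a measure,
    so agreement on boxes is enough, and there the previous inequality applies in both
    directions. *)
Lemma invariant_measure_unique (m1 m2 : {finite_measure set (d.-tuple R) -> \bar R}) :
  rotation_invariant m1 -> m1 (~` S) = 0 ->
  rotation_invariant m2 -> m2 (~` S) = 0 ->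
  forall A, measurable A -> m1 A * m2 setT = m2 A * m1 setT.
Proof.
move=> m1_inv m1S m2_inv m2S.
have f1 : m1 setT \is a fin_num by exact: fin_num_measure.
have f2 : m2 setT \is a fin_num by exact: fin_num_measure.
have t1 : (0 <= fine (m1 setT))%R by exact: fine_ge0.
have t2 : (0 <= fine (m2 setT))%R by exact: fine_ge0.
have sc1 A : mscale (NngNum t2) m1 A = m2 setT * m1 A by rewrite /mscale /= fineK.
have sc2 A : mscale (NngNum t1) m2 A = m1 setT * m2 A by rewrite /mscale /= fineK.
move=> A mA; rewrite muleC -sc1 muleC -sc2.
apply: (@measure_pi_unique _ _ _ (boxes (@lower_rays R))) mA.
- exact: (measurable_tuple_boxes _ (measurable_lower_rays R) (lower_rays_setT R)).
- exact: boxes_setI_closed (@lower_rays_setI_closed R).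
- exact: boxes_setT (lower_rays_setT R).
- by rewrite [ltLHS]sc1 ltey_eq fin_numM.
move=> G bG; rewrite [LHS]sc1 [RHS]sc2 muleC [RHS]muleC.
by apply/eqP; rewrite eq_le !invariant_box_le.
Qed.
End invariant_uniqueness.

(* The proofs [mD] and [mf] are arguments so that the measure instance below can be
   inferred from the term. *)
Definition restricted_image d1 d2 (T1 : measurableType d1) (T2 : measurableType d2)
    (R : realType) (m : set T1 -> \bar R) (D : set T1) (mD : measurable D)
    (f : T1 -> T2) (mf : measurable_fun setT f) (A : set T2) : \bar R :=
  m (D `&` f @^-1` A).

Section restricted_image_measure.
Local Open Scope ereal_scope.
Context d1 d2 (T1 : measurableType d1) (T2 : measurableType d2) (R : realType).
Variables (m : {finite_measure set T1 -> \bar R}) (D : set T1).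
Hypothesis mD : measurable D.
Variable f : T1 -> T2.
Hypothesis mf : measurable_fun setT f.
Notation mu := (restricted_image m mD mf).

Let mpre A : measurable A -> measurable (D `&` f @^-1` A).
Proof. by move=> mA; apply: measurableI => //; exact: measurable_preimageT. Qed.

Let mu0 : mu set0 = 0.
Proof. by rewrite /restricted_image preimage_set0 setI0 measure0. Qed.

Let mu_ge0 A : 0 <= mu A. Proof. exact: measure_ge0. Qed.

Let mu_sigma_additive : semi_sigma_additive mu.
Proof.
move=> F mF tF mUF; rewrite /restricted_image preimage_bigcup setI_bigcupr.
apply: measure_semi_sigma_additive.
- by move=> n; exact: mpre.
- apply/trivIsetP => i j _ _ ij; rewrite setIACA -[X in _ `&` X]preimage_setI.
  by move/trivIsetP : tF => /(_ _ _ _ _ ij) ->//; rewrite preimage_set0 setI0.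
- by rewrite -setI_bigcupr -preimage_bigcup; exact: mpre.
Qed.

HB.instance Definition _ := isMeasure.Build _ _ _ mu mu0 mu_ge0 mu_sigma_additive.

Let mu_fin : fin_num_fun mu.
Proof. by move=> A mA; apply: fin_num_measure; exact: mpre. Qed.

HB.instance Definition _ := Measure_isFinite.Build _ _ _ mu mu_fin.

End restricted_image_measure.

(** Both the events and the maps may differ on the two sides: in the exchange of directions, one
    direction is constrained by the event and the other is read by the map. *)
Lemma preimage_pi_unique d1 d2 (T1 : measurableType d1) (T2 : measurableType d2)
    (R : realType) (m : {finite_measure set T1 -> \bar R}) (G : set (set T2))
    (D1 D2 : set T1) (f1 f2 : T1 -> T2) :
  measurable = <<s G >> -> setI_closed G -> G setT ->
  measurable D1 -> measurable D2 ->
  measurable_fun setT f1 -> measurable_fun setT f2 ->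
  (forall A, G A -> m (D1 `&` f1 @^-1` A) = m (D2 `&` f2 @^-1` A)) ->
  forall A, measurable A -> m (D1 `&` f1 @^-1` A) = m (D2 `&` f2 @^-1` A).
Proof.
move=> mG IG GT mD1 mD2 mf1 mf2 eqG A mA.
apply: (@measure_pi_unique _ _ _ G (restricted_image m mD1 mf1)
  (restricted_image m mD2 mf2)) mA => //.
by rewrite ltey_eq fin_num_measure.
Qed.

(** * Exchangeability of directions *)

Section polar.
Context {R : realType} {d : nat}.
Implicit Types (x : d.-tuple R) (P Q : probability (d.-tuple R) R).

(* [direction x] is 0 when [x] is, since 0^-1 = 0. *)
Definition direction x := tscale (enorm x)^-1 x.

Lemma enorm_direction x : enorm x != 0 -> enorm (direction x) = 1.
Proof.
move=> x0; rewrite /direction enorm_tscale ger0_norm ?invr_ge0 ?enorm_ge0//.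
by rewrite mulVf.
Qed.

Lemma tscale_direction x : tscale (enorm x) (direction x) = x.
Proof.
have [x0|x0] := eqVneq (enorm x) 0; last by rewrite tscaleA divff// tscale1.
rewrite x0; move/eqP: x0; rewrite enorm_eq0 => /eqP ->.
by apply: eq_from_tnth => i; rewrite !tnth_mktuple mul0r.
Qed.

Lemma measurable_direction : measurable_fun setT direction.
Proof.
apply: measurable_tscale => //.
(* Power and inverse agree on nonnegative reals, 0 included, and the power is measurable on the
   whole line. *)
rewrite (_ : (fun _ => _) = fun x => enorm x `^ (-1)); last first.
  by apply/funext => x; rewrite powR_inv1// enorm_ge0.
apply: (@measurableT_comp _ _ _ _ _ _ (fun r : R => r `^ (-1)) setT (@enorm R d)).
  exact: measurable_powR.
by apply: measurable_enorm; exact: measurable_id.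
Qed.

Lemma direction_lin_act (H : 'M[R]_d) x : orthogonal_mx H ->
  direction (lin_act H x) = lin_act H (direction x).
Proof. by move=> oH; rewrite /direction enorm_lin_act// lin_act_tscale. Qed.

Lemma uniform_on_sphere_setC Q : uniform_on_sphere Q -> Q (~` @usphere R d) = 0%E.
Proof.
move=> [Q1 _]; rewrite probability_setC; last exact: measurable_usphere.
by rewrite [Q _]Q1 subee.
Qed.

(** For fixed [E], the left-hand side is, as a function of [B], a rotation invariant finite measure
    carried by the sphere. It is therefore proportional to [Q], and its total mass is the first
    factor on the right. Excluding the origin keeps this measure on the sphere, [direction] being 0
    there. *)
Lemma polar_independence P Q (E : set R) (B : set (d.-tuple R)) :
  spherically_symmetric P -> uniform_on_sphere Q -> measurable E -> measurable B ->
  P [set x | [/\ enorm x != 0%R, E (enorm x) & B (direction x)]] =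
  (P [set x | enorm x != 0%R /\ E (enorm x)] * Q B)%E.
Proof.
move=> Psym Qu mE mB.
have menorm : measurable_fun setT (@enorm R d).
  by apply: measurable_enorm; exact: measurable_id.
pose D := [set x : d.-tuple R | enorm x != 0 /\ E (enorm x)].
have mD : measurable D.
  have mn0 : measurable [set x : d.-tuple R | enorm x != 0].
    rewrite (_ : [set _ | _] = ~` ((@enorm R d) @^-1` [set 0])).
      by apply: measurableC; exact: measurable_preimageT.
    by rewrite predeqE => x; split=> /= /eqP.
  exact: (measurableI _ _ mn0 (measurable_preimageT menorm mE)).
have mdir := measurable_direction.
have key : (P (D `&` direction @^-1` B) * Q setT =
    Q B * P (D `&` direction @^-1` setT))%E.
  apply: (@invariant_measure_unique R d (restricted_image P mD mdir) Q) => //.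
  - move=> H oH A mA; rewrite /restricted_image /= -[RHS](Psym H oH).
      congr (P _); rewrite predeqE => x; rewrite /D /= enorm_lin_act//.
      by rewrite direction_lin_act.
    by apply: measurableI => //; exact: measurable_preimageT.
  - rewrite /= /restricted_image (_ : _ `&` _ = set0) ?measure0// -subset0.
    by move=> x [[x0 _]]; apply; exact: enorm_direction.
  - by case: Qu.
  - exact: uniform_on_sphere_setC.
move: key; rewrite preimage_setT setIT probability_setT mule1 [RHS]muleC => <-.
by congr (P _); rewrite predeqE => x; split => [[? ? ?]|[[? ?] ?]].
Qed.

End polar.

Lemma measurable_prod_rectangles d1 d2 (T1 : measurableType d1)
    (T2 : measurableType d2) (C1 : set (set T1)) (C2 : set (set T2)) :
  measurable = <<s C1 >> -> C1 setT -> measurable = <<s C2 >> -> C2 setT ->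
  (measurable : set (set (T1 * T2))) = <<s [set A `*` B | A in C1 & B in C2] >>.
Proof.
move=> mC1 C1T mC2 C2T; rewrite eqEsubset; split; last first.
  apply: smallest_sub; first exact: sigma_algebra_measurable.
  move=> _ [A CA [B CB <-]]; apply: measurableX.
    by rewrite mC1; apply: sub_sigma_algebra.
  by rewrite mC2; apply: sub_sigma_algebra.
apply: smallest_sub; first exact: smallest_sigma_algebra.
move=> _ [[A mA <-]|[A mA <-]].
- move: mA; rewrite mC1 => mA.
  have : preimage_set_system setT fst <<s C1>> `<=`
      <<s [set A `*` B | A in C1 & B in C2] >>; last by apply; exists A.
  rewrite -g_sigma_preimageE; apply: smallest_sub.
    exact: smallest_sigma_algebra.
  move=> _ [D CD <-]; apply: sub_sigma_algebra; exists D => //; exists setT => //.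
  by rewrite setTI predeqE => -[x y]; split => [[]|] //.
- move: mA; rewrite mC2 => mA.
  have : preimage_set_system setT snd <<s C2>> `<=`
      <<s [set A `*` B | A in C1 & B in C2] >>; last by apply; exists A.
  rewrite -g_sigma_preimageE; apply: smallest_sub.
    exact: smallest_sigma_algebra.
  move=> _ [D CD <-]; apply: sub_sigma_algebra; exists setT => //; exists D => //.
Qed.

Lemma setI_closed_rectangles T1 T2 (C1 : set (set T1)) (C2 : set (set T2)) :
  setI_closed C1 -> setI_closed C2 ->
  setI_closed [set A `*` B | A in C1 & B in C2].
Proof.
move=> I1 I2 _ _ [A1 CA1 [B1 CB1 <-]] [A2 CA2 [B2 CB2 <-]].
by exists (A1 `&` A2); [exact: I1|exists (B1 `&` B2); [exact: I2|rewrite setXI]].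
Qed.

Section exchange.
Context {R : realType} {n d : nat} {disp : measure_display}.
Context {Omega : measurableType disp}.
Variables (Pr : probability Omega R) (P : probability (d.-tuple R) R).
Variables (X U : 'I_n -> {RV Pr >-> d.-tuple R}).
Hypotheses (P_sym : spherically_symmetric P).
Hypotheses (Xlaw : forall i, has_law (X i) P) (Xind : mutually_independent X).
Hypotheses (Ulaw : forall i, uniform_on_sphere (distribution Pr (U i))).
Hypotheses (Uind : mutually_independent U) (XU : independent_families X U).

Let mX i : measurable_fun setT (X i). Proof. exact: measurable_funPT. Qed.
Let mU i : measurable_fun setT (U i). Proof. exact: measurable_funPT. Qed.

Definition others (i : 'I_n) (A B : 'I_n -> set (d.-tuple R)) : set Omega :=
  [set w | forall j, j != i -> A j (X j w) /\ B j (U j w)].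

Lemma measurable_others i A B : (forall j, measurable (A j)) ->
  (forall j, measurable (B j)) -> measurable (others i A B).
Proof.
move=> mA mB.
rewrite (_ : others i A B =
    \bigcap_(j in [set j | j != i]) ((X j @^-1` A j) `&` (U j @^-1` B j))).
  apply: fin_bigcap_measurable => [|j _]; first exact: finite_finset.
  by apply: measurableI; exact: measurable_preimageT.
by rewrite predeqE => w; split=> h j; exact: h.
Qed.

Lemma others_factor i A B (A' B' : set (d.-tuple R)) :
  (forall j, measurable (A j)) -> (forall j, measurable (B j)) ->
  measurable A' -> measurable B' ->
  Pr (others i A B `&` [set w | A' (X i w) /\ B' (U i w)]) =
  (((\prod_(j < n | j != i) Pr (X j @^-1` A j)) *
   (\prod_(j < n | j != i) Pr (U j @^-1` B j))) *
   (P A' * distribution Pr (U i) B'))%E.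
Proof.
move=> mA mB mA' mB'.
pose A2 j := if j == i then A' else A j.
pose B2 j := if j == i then B' else B j.
have mA2 j : measurable (A2 j) by rewrite /A2; case: ifP.
have mB2 j : measurable (B2 j) by rewrite /B2; case: ifP.
have := XU (measurable_box mA2) (measurable_box mB2).
have jointE (Z : 'I_n -> {RV Pr >-> d.-tuple R}) (D : 'I_n -> set (d.-tuple R)) :
    joint Z @^-1` [set t | forall j, D j (tnth t j)] = [set w | forall j, D j (Z j w)].
  rewrite predeqE => w; split=> h j; have := h j; by rewrite tnth_mktuple.
rewrite !jointE Xind// Uind// (bigD1 i)//= [X in (_ * X)%E](bigD1 i)//=.
have A2i : A2 i = A' by rewrite /A2 eqxx.
have B2i : B2 i = B' by rewrite /B2 eqxx.
rewrite A2i B2i.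
have -> : Pr (X i @^-1` A') = P A' by rewrite -(Xlaw i).
have -> : (\prod_(j < n | j != i) Pr (X j @^-1` A2 j) =
    \prod_(j < n | j != i) Pr (X j @^-1` A j))%E.
  by apply: eq_bigr => j ji; rewrite /A2 (negbTE ji).
have -> : (\prod_(j < n | j != i) Pr (U j @^-1` B2 j) =
    \prod_(j < n | j != i) Pr (U j @^-1` B j))%E.
  by apply: eq_bigr => j ji; rewrite /B2 (negbTE ji).
rewrite muleACA muleC => <-; congr (Pr _); rewrite predeqE => w; split.
  move=> [h [hA hB]]; split => j; rewrite /A2 /B2; case: eqP => [->//|/eqP ji].
    by have [] := h _ ji.
  by have [] := h _ ji.
move=> [hA hB]; split => [j ji|].
  by have := hA j; have := hB j; rewrite /A2 /B2 (negbTE ji).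
by have := hA i; have := hB i; rewrite /A2 /B2 eqxx.
Qed.

Definition nonzero i : set Omega := [set w | enorm (X i w) != 0].

Lemma measurable_nonzero i : measurable (nonzero i).
Proof.
rewrite (_ : nonzero i = ~` ((@enorm R d \o X i) @^-1` [set 0])).
  apply: measurableC; apply: measurable_preimageT => //.
  by apply: measurable_enorm; exact: mX.
by rewrite predeqE => w; split=> /= /eqP.
Qed.

(** Given a nonzero X_i, the triples (|X_i|, V_i, U_i) and (|X_i|, U_i, V_i) have the same law,
    jointly with the other pairs. *)
Lemma polar_swap_box i A B : (forall j, measurable (A j)) ->
  (forall j, measurable (B j)) ->
  Pr (others i A B `&` nonzero i `&` [set w | A i (X i w) /\ B i (U i w)]) =
  Pr (others i A B `&` nonzero i `&`
      [set w | A i (tscale (enorm (X i w)) (U i w)) /\ B i (direction (X i w))]).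
Proof.
move=> mA mB.
pose V w := direction (X i w).
have mV : measurable_fun setT V.
  by apply: (measurableT_comp measurable_direction); exact: mX.
have mN : measurable_fun setT (fun w => enorm (X i w)) by apply: measurable_enorm.
have menorm : measurable_fun setT (@enorm R d).
  by apply: measurable_enorm; exact: measurable_id.
have mE0 := measurable_others i mA mB.
pose D1 := others i A B `&` nonzero i `&` (U i @^-1` B i).
pose D2 := others i A B `&` nonzero i `&` (V @^-1` B i).
have mD1 : measurable D1.
  apply: measurableI; last exact: measurable_preimageT.
  by apply: measurableI => //; exact: measurable_nonzero.
have mD2 : measurable D2.
  apply: measurableI; last exact: measurable_preimageT.
  by apply: measurableI => //; exact: measurable_nonzero.
pose f1 w : R * d.-tuple R := (enorm (X i w), V w).
pose f2 w : R * d.-tuple R := (enorm (X i w), U i w).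
have mf1 : measurable_fun setT f1 by apply: measurable_fun_pair.
have mf2 : measurable_fun setT f2 by apply: measurable_fun_pair.
pose polar (E : set R) (F : set (d.-tuple R)) :=
  [set x : d.-tuple R | [/\ enorm x != 0, E (enorm x) & F (direction x)]].
have mpolar E F : measurable E -> measurable F -> measurable (polar E F).
  move=> mE mF.
  rewrite (_ : polar E F = ~` ((@enorm R d) @^-1` [set 0]) `&`
      ((@enorm R d) @^-1` E `&` direction @^-1` F)).
    apply: measurableI; first by apply: measurableC; exact: measurable_preimageT.
    apply: measurableI; apply: measurable_preimageT => //.
    exact: measurable_direction.
  by rewrite predeqE => x; split => [[/eqP ? ? ?]|[/= /eqP ? [? ?]]]; split.
pose D : set (R * d.-tuple R) := (fun p => tscale p.1 p.2) @^-1` A i.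
have mD : measurable D.
  apply: measurable_preimageT => //; apply: measurable_tscale => //.
(* In polar coordinates [A i] becomes [D], which is not a rectangle. On a rectangle E x F both sides
   factor, and the product is symmetric in [F] and [B i]. *)
have key : Pr (D1 `&` f1 @^-1` D) = Pr (D2 `&` f2 @^-1` D).
  apply: (@preimage_pi_unique _ _ _ _ _ Pr
    [set E `*` F | E in measurable & F in measurable]) mD => //.
  - exact: measurable_prod_measurableType.
  - by apply: setI_closed_rectangles => ? ? ? ?; exact: measurableI.
  - by exists setT => //; exists setT => //; rewrite setXTT.
  move=> _ [E mE [F mF <-]].
  transitivity (Pr (others i A B `&` [set w | polar E F (X i w) /\ B i (U i w)])).
    congr (Pr _); rewrite predeqE => w; split.
      by move=> [[[? ?] ?] [/= ? ?]].
    by move=> [? [[? ? ?] ?]].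
  transitivity (Pr (others i A B `&` [set w | polar E (B i) (X i w) /\ F (U i w)])).
    rewrite !others_factor//; [|exact: mpolar..].
    rewrite !(@polar_independence _ _ P (distribution Pr (U i)))//.
    by congr (_ * _)%E; rewrite muleAC.
  congr (Pr _); rewrite predeqE => w; split.
    by move=> [? [[? ? ?] ?]].
  by move=> [[[? ?] ?] [/= ? ?]].
transitivity (Pr (D1 `&` f1 @^-1` D)).
  congr (Pr _); rewrite predeqE => w; split.
    by move=> [[? ?] [? ?]]; split => //; rewrite /D /f1 /= tscale_direction.
  by move=> [[[? ?] ?]]; rewrite /D /f1 /= tscale_direction.
rewrite key; congr (Pr _); rewrite predeqE => w; split.
  by move=> [[[? ?] ?] ?].
by move=> [[? ?] [? ?]].
Qed.

(* Exchanges [x_i] and [|x_i| u_i] when [x_i] is nonzero and [|u_i| = 1]. *)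
Definition swap_polar (i : 'I_n) (p : n.-tuple (d.-tuple R) * n.-tuple (d.-tuple R)) :
    n.-tuple (d.-tuple R) * n.-tuple (d.-tuple R) :=
  ([tuple if j == i then tscale (enorm (tnth p.1 i)) (tnth p.2 i) else tnth p.1 j | j < n],
   [tuple if j == i then direction (tnth p.1 i) else tnth p.2 j | j < n]).

Lemma measurable_joint (Z : 'I_n -> {RV Pr >-> d.-tuple R}) :
  measurable_fun setT (joint Z).
Proof.
apply/measurable_fun_tnthP => i.
rewrite (_ : _ \o _ = Z i); first exact: measurable_funPT.
by apply/funext => w /=; rewrite tnth_mktuple.
Qed.

Lemma measurable_swap_polar i : measurable_fun setT (swap_polar i).
Proof.
have m1 j : measurable_fun setT
    (fun p : n.-tuple (d.-tuple R) * n.-tuple (d.-tuple R) => tnth p.1 j).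
  exact: (measurableT_comp (measurable_tnth _) measurable_fst).
have m2 j : measurable_fun setT
    (fun p : n.-tuple (d.-tuple R) * n.-tuple (d.-tuple R) => tnth p.2 j).
  exact: (measurableT_comp (measurable_tnth _) measurable_snd).
apply: measurable_fun_pair; apply/measurable_fun_tnthP => j.
- rewrite (_ : _ \o _ = fun p => if j == i
    then tscale (enorm (tnth p.1 i)) (tnth p.2 i) else tnth p.1 j); last first.
    by apply/funext => p /=; rewrite tnth_mktuple.
  case: (j == i) => //; apply: measurable_tscale => //.
  exact: measurable_enorm.
- rewrite (_ : _ \o _ = fun p => if j == i
    then direction (tnth p.1 i) else tnth p.2 j); last first.
    by apply/funext => p /=; rewrite tnth_mktuple.
  case: (j == i) => //.
  exact: (measurableT_comp measurable_direction).
Qed.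

(** On products of boxes the i-th pair separates from the others and this is [polar_swap_box]; such
    products generate the sigma-algebra. *)
Lemma swap_polar_law i D : measurable D ->
  Pr (nonzero i `&` [set w | D (joint X w, joint U w)]) =
  Pr (nonzero i `&` [set w | D (swap_polar i (joint X w, joint U w))]).
Proof.
pose W w := (joint X w, joint U w).
have mW : measurable_fun setT W by apply: measurable_fun_pair; exact: measurable_joint.
have mSW : measurable_fun setT (swap_polar i \o W).
  exact: (measurableT_comp (measurable_swap_polar i)).
have mn := measurable_nonzero i.
have gen : (measurable : set (set (n.-tuple (d.-tuple R)))) =
    <<s boxes (measurable : set (set (d.-tuple R))) >>.
  apply: measurable_tuple_boxes => //.
  by rewrite sigma_algebra_id//; exact: sigma_algebra_measurable.
have genI : setI_closed (@boxes _ n (measurable : set (set (d.-tuple R)))).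
  by apply: boxes_setI_closed => ? ? ? ?; exact: measurableI.
have genT : (@boxes _ n (measurable : set (set (d.-tuple R)))) setT.
  by apply: boxes_setT.
move=> mD.
apply: (@preimage_pi_unique _ _ _ _ _ Pr _ (nonzero i) (nonzero i) W
  (swap_polar i \o W) (measurable_prod_rectangles gen genT gen genT)) mD => //.
- exact: setI_closed_rectangles.
- by exists setT => //; exists setT => //; rewrite setXTT.
move=> _ [_ [A mA ->] [_ [B mB ->] <-]].
transitivity (Pr (others i A B `&` nonzero i `&` [set w | A i (X i w) /\ B i (U i w)])).
  congr (Pr _); rewrite predeqE => w; split.
    move=> [nz [/= hA hB]]; split; first split=> //.
      by move=> j ji; move: (hA j) (hB j); rewrite !tnth_mktuple.
    by move: (hA i) (hB i); rewrite !tnth_mktuple.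
  move=> [[h nz] [hA hB]]; split => //; split => j; rewrite tnth_mktuple;
    by have [->//|ji] := eqVneq j i; have [] := h _ ji.
rewrite polar_swap_box//; congr (Pr _); rewrite predeqE => w; split.
  move=> [[h nz] [hA hB]]; split => //; split => j; rewrite !tnth_mktuple;
    by have [->//|ji] := eqVneq j i; have [] := h _ ji; rewrite ?tnth_mktuple.
move=> [nz [/= hA hB]]; split; first split=> //.
  move=> j ji; move: (hA j) (hB j).
  by rewrite !tnth_mktuple (negbTE ji).
by move: (hA i) (hB i); rewrite !tnth_mktuple eqxx.
Qed.

End exchange.

(** * Distribution of the labels along the optimal path *)

Definition flip n (i : 'I_n) (s : {ffun 'I_n -> bool}) : {ffun 'I_n -> bool} :=
  [ffun j => (j == i) (+) s j].

Lemma flipK n (i : 'I_n) : involutive (flip i).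
Proof. by move=> s; apply/ffunP => j; rewrite !ffunE addbA addbb. Qed.

Definition flip_path n (i : 'I_n) (c : labelled_path n) : labelled_path n :=
  (flip i c.1, c.2).

Lemma flip_pathK n (i : 'I_n) : involutive (flip_path i).
Proof. by move=> [s p]; rewrite /flip_path /= flipK. Qed.

(** One passes from [s] to [t] one coordinate at a time, each change being a flip. *)
Lemma flip_invariant_const n (T : Type) (f : {ffun 'I_n -> bool} -> T) :
  (forall i s, f (flip i s) = f s) -> forall s t, f s = f t.
Proof.
move=> fI s t.
pose mix k : {ffun 'I_n -> bool} := [ffun j : 'I_n => if (j < k)%N then t j else s j].
have mixE k : f (mix k) = f s.
  elim: k => [|k IH]; first by congr f; apply/ffunP => j; rewrite ffunE.
  rewrite -IH; have [kn|kn] := ltnP k n; last first.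
    congr f; apply/ffunP => j; rewrite !ffunE.
    by rewrite (leq_trans (ltn_ord j) kn) (leq_trans (ltn_ord j) (leqW kn)).
  pose i := Ordinal kn.
  have [ts|ts] := eqVneq (t i) (s i).
    congr f; apply/ffunP => j; rewrite !ffunE ltnS leq_eqVlt.
    by case: (eqVneq (j : nat) k) => //= jk; rewrite jk ltnn (_ : j = i)//; apply: val_inj.
  rewrite -(fI i (mix k)); congr f; apply/ffunP => j; rewrite !ffunE ltnS leq_eqVlt.
  have [->/=|ji] := eqVneq j i; first by rewrite eqxx ltnn; case: (t i) (s i) ts => [] [].
  rewrite (_ : (j == k :> nat) = false)//.
  by apply: contra_neqF ji => /eqP jk; apply: val_inj.
rewrite -(mixE n); congr f; apply/ffunP => j.
by rewrite ffunE ltn_ord.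
Qed.

Lemma measurable_sum_cond disp (T : measurableType disp) (R : realType)
    (I : finType) (P : pred I) (h : I -> T -> R) :
  (forall i, P i -> measurable_fun setT (h i)) ->
  measurable_fun setT (fun x => \sum_(i | P i) h i x).
Proof.
move=> mh.
have -> : (fun x => \sum_(i | P i) h i x) =
    fun x => \sum_(i <- index_enum I) (if P i then h i x else 0).
  by apply/funext => x; rewrite big_mkcond.
apply: (@measurable_sum _ _ _ setT _ _ (fun i x => if P i then h i x else 0)).
by move=> i; have [/mh//|_] := boolP (P i); exact: measurable_cst.
Qed.

(** * Effect of the exchange on the minimizers *)

Section swap_minimizers.
Context {R : realType} {n d : nat}.
Implicit Types (p : n.-tuple (d.-tuple R) * n.-tuple (d.-tuple R)) (c : labelled_path n).

Lemma path_cost_eq p p' c c' : c.2 = c'.2 ->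
  (forall j, Yvec p.1 p.2 (c.1 j) j = Yvec p'.1 p'.2 (c'.1 j) j) ->
  path_cost p.1 p.2 c = path_cost p'.1 p'.2 c'.
Proof.
move=> c2 h; rewrite /path_cost; apply: eq_bigr => i _; apply: eq_bigr => j _.
by rewrite c2 !h.
Qed.

(** The exchange turns the i-th point into its variant. Since |u_i| = 1 the radius is kept, so the
    variant of the new point is the old point: the two candidates for Y_i trade places. *)
Lemma path_cost_swap_polar i p c :
  enorm (tnth p.1 i) != 0 -> enorm (tnth p.2 i) = 1 ->
  path_cost (swap_polar i p).1 (swap_polar i p).2 c =
  path_cost p.1 p.2 (flip_path i c).
Proof.
move=> xi ui; apply: path_cost_eq => // j.
rewrite /Yvec /spherical_variant /= ffunE !tnth_mktuple.
have [->|//] := eqVneq j i.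
case: (c.1 i) => //=.
rewrite enorm_tscale ui mulr1 ger0_norm ?enorm_ge0//.
exact: tscale_direction.
Qed.

(** At the origin the point and its variant coincide, so the i-th label does not affect the cost. *)
Lemma path_cost_flip0 i p c : enorm (tnth p.1 i) = 0 ->
  path_cost p.1 p.2 (flip_path i c) = path_cost p.1 p.2 c.
Proof.
move=> xi; apply: path_cost_eq => // j.
rewrite /Yvec /spherical_variant /= ffunE.
have [->|//] := eqVneq j i.
rewrite xi; have /eqP := xi; rewrite enorm_eq0 => /eqP ->.
have -> : tscale 0 (tnth p.2 i) = [tuple 0 | _ < d].
  by apply: eq_from_tnth => k; rewrite !tnth_mktuple mul0r.
by case: (c.1 i).
Qed.

Lemma mem_minimizers_flip p p' i c :
  (forall c, path_cost p'.1 p'.2 c = path_cost p.1 p.2 (flip_path i c)) ->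
  (c \in minimizers p'.1 p'.2) = (flip_path i c \in minimizers p.1 p.2).
Proof.
move=> h; rewrite !inE; apply/forallP/forallP => hc c'.
  by have := hc (flip_path i c'); rewrite !h flip_pathK.
by rewrite !h; exact: hc.
Qed.

Lemma minimizers_swap_polar i p :
  enorm (tnth p.1 i) != 0 -> enorm (tnth p.2 i) = 1 ->
  minimizers (swap_polar i p).1 (swap_polar i p).2 =
  flip_path i @^-1: minimizers p.1 p.2.
Proof.
move=> xi ui; apply/setP => c; rewrite [RHS]inE.
by apply: mem_minimizers_flip => c'; exact: path_cost_swap_polar.
Qed.

Lemma minimizers_flip0 i p : enorm (tnth p.1 i) = 0 ->
  flip_path i @^-1: minimizers p.1 p.2 = minimizers p.1 p.2.
Proof.
move=> xi; apply/setP => c; rewrite [LHS]inE -(mem_minimizers_flip (p' := p))//.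
by move=> c'; rewrite path_cost_flip0.
Qed.

Lemma measurable_path_cost c : measurable_fun setT
  (fun p : n.-tuple (d.-tuple R) * n.-tuple (d.-tuple R) => path_cost p.1 p.2 c).
Proof.
have m1 j : measurable_fun setT
    (fun p : n.-tuple (d.-tuple R) * n.-tuple (d.-tuple R) => tnth p.1 j).
  exact: (measurableT_comp (measurable_tnth _) measurable_fst).
have m2 j : measurable_fun setT
    (fun p : n.-tuple (d.-tuple R) * n.-tuple (d.-tuple R) => tnth p.2 j).
  exact: (measurableT_comp (measurable_tnth _) measurable_snd).
have mY s j : measurable_fun setT
    (fun p : n.-tuple (d.-tuple R) * n.-tuple (d.-tuple R) => Yvec p.1 p.2 s j).
  rewrite /Yvec; case: s => //; rewrite /spherical_variant.
  apply: measurable_tscale => //.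
  exact: measurable_enorm.
rewrite /path_cost /=.
apply: measurable_sum_cond => i _; apply: measurable_sum_cond => j _.
rewrite /theta.
apply: (measurableT_comp (@measurable_expR R)).
apply: (measurableT_comp (@oppr_measurable R setT)).
apply: measurable_funX; apply: measurable_funM => //.
exact: measurable_dot.
Qed.

Lemma measurable_minimizers (M : {set labelled_path n}) :
  measurable [set p : n.-tuple (d.-tuple R) * n.-tuple (d.-tuple R) |
    minimizers p.1 p.2 = M].
Proof.
have mmem c : measurable [set p : n.-tuple (d.-tuple R) * n.-tuple (d.-tuple R) |
    c \in minimizers p.1 p.2].
  rewrite (_ : [set _ | _] = \bigcap_(c' in [set: labelled_path n])
      ~` [set p | path_cost p.1 p.2 c' < path_cost p.1 p.2 c]).
    apply: fin_bigcap_measurable => [|c' _]; first exact: finite_finset.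
    by apply: measurableC; apply: measurable_set_ltr; exact: measurable_path_cost.
  rewrite predeqE => p; rewrite /= inE; split => [/forallP h c' _ /=|h].
    by apply/negP; rewrite -leNgt.
  by apply/forallP => c'; rewrite leNgt; apply/negP; exact: h.
rewrite (_ : [set _ | _] = \bigcap_(c in [set: labelled_path n])
    [set p | (c \in minimizers p.1 p.2) = (c \in M)]).
  apply: fin_bigcap_measurable => [|c _]; first exact: finite_finset.
  case: (c \in M); first exact: mmem.
  rewrite (_ : [set _ | _] = ~` [set p | c \in minimizers p.1 p.2]).
    exact: measurableC.
  by rewrite predeqE => p /=; split => [->|/negP/negbTE].
rewrite predeqE => p; split => [<- //|h].
by apply/setP => c; exact: h.
Qed.

End swap_minimizers.

Lemma measure_finite_partition disp (T : measurableType disp) (R : realType)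
    (m : {measure set T -> \bar R}) (I : finType) (f : T -> I) (F : set T) :
  (forall i, measurable (f @^-1` [set i])) -> measurable F ->
  m F = (\sum_i m (F `&` f @^-1` [set i]))%E.
Proof.
move=> mf mF.
have part (r : seq I) : uniq r -> measurable (F `&` [set t | f t \in r]) /\
    m (F `&` [set t | f t \in r]) = (\sum_(i <- r) m (F `&` f @^-1` [set i]))%E.
  elim: r => [_|i r IH /= /andP[ir ur]].
    rewrite (_ : _ `&` _ = set0) ?big_nil ?measure0//.
    by rewrite predeqE => t; split=> // -[_ /=]; rewrite in_nil.
  have [mr Er] := IH ur.
  have -> : F `&` [set t | f t \in i :: r] =
      (F `&` f @^-1` [set i]) `|` (F `&` [set t | f t \in r]).
    rewrite -setIUr; congr (_ `&` _); rewrite predeqE => t /=; rewrite in_cons.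
    by split=> [/orP[/eqP|]|[->|->]]; rewrite ?eqxx ?orbT//; [left|right].
  have mi : measurable (F `&` f @^-1` [set i]) by exact: measurableI.
  split; first exact: measurableU.
  rewrite big_cons -Er measureU// -subset0 => t [[_ /= fi] [_ /=]].
  by rewrite fi (negbTE ir).
have [_ <-] := part _ (index_enum_uniq I).
by congr (m _); rewrite predeqE => t; split=> [Ft|[]//]; split=> //=; rewrite mem_index_enum.
Qed.

Lemma measure_eq_off_null disp (T : measurableType disp) (R : realType)
    (m : {measure set T -> \bar R}) (A B N : set T) :
  measurable A -> measurable B -> measurable N -> m N = 0%E ->
  (forall t, ~ N t -> A t <-> B t) -> m A = m B.
Proof.
move=> mA mB mN N0 AB.
have mE C : measurable C -> m C = m (C `\` N).
  move=> mC; rewrite (measureDI m mC mN) [X in (_ + X)%E](_ : _ = 0%E) ?adde0//.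
  exact: (subset_measure0 (measurableI _ _ mC mN) mN (@subIsetr _ _ _) N0).
rewrite (mE A)// (mE B)//; congr (m _); rewrite predeqE => t.
by split=> -[h nN]; split=> //; apply/AB.
Qed.

Section label_law.
Context {R : realType} {n d : nat} {disp : measure_display}.
Context {Omega : measurableType disp}.
Variables (Pr : probability Omega R) (P : probability (d.-tuple R) R).
Variables (X U : 'I_n -> {RV Pr >-> d.-tuple R}).
Hypotheses (P_sym : spherically_symmetric P).
Hypotheses (Xlaw : forall i, has_law (X i) P) (Xind : mutually_independent X).
Hypotheses (Ulaw : forall i, uniform_on_sphere (distribution Pr (U i))).
Hypotheses (Uind : mutually_independent U) (XU : independent_families X U).

Let argmin w := minimizers (joint X w) (joint U w).

Lemma measurable_argmin M : measurable [set w | argmin w = M].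
Proof.
pose W w := (joint X w, joint U w).
have mW : measurable_fun setT W by apply: measurable_fun_pair; exact: measurable_joint.
exact: (measurable_preimageT mW (measurable_minimizers M)).
Qed.

(** Where X_i = 0 the set of minimizers is its own flip; elsewhere the exchange preserves the law
    and flips the set, outside the null event that U_i is off the sphere. *)
Lemma argmin_flip_law i M :
  Pr [set w | argmin w = M] = Pr [set w | argmin w = flip_path i @^-1: M].
Proof.
have fK (N N' : {set labelled_path n}) :
    flip_path i @^-1: N = N' -> N = flip_path i @^-1: N'.
  by move=> <-; apply/setP => c; rewrite !inE flip_pathK.
have mn := measurable_nonzero X i.
have ma := measurable_argmin.
rewrite (measureDI Pr (ma M) mn) (measureDI Pr (ma (flip_path i @^-1: M)) mn).
congr (_ + _)%E.
  congr (Pr _); rewrite predeqE => w.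
  have h : ~ nonzero X i w -> flip_path i @^-1: argmin w = argmin w.
    move=> /negP/negPn/eqP x0.
    by apply: (minimizers_flip0 (p := (joint X w, joint U w))); rewrite tnth_mktuple.
  split=> -[/= e z]; split=> //=.
    by apply: fK; rewrite h.
  by rewrite -h// e; apply/setP => c; rewrite !inE flip_pathK.
rewrite setIC.
transitivity (Pr (nonzero X i `&`
    [set w | minimizers (swap_polar i (joint X w, joint U w)).1
                        (swap_polar i (joint X w, joint U w)).2 = M])).
  exact: (swap_polar_law P_sym Xlaw Xind Ulaw Uind XU i (measurable_minimizers M)).
pose N := U i @^-1` (~` @usphere R d).
have mU : measurable_fun setT (U i) by exact: measurable_funPT.
have mN : measurable N.
  by apply: measurable_preimageT => //; apply: measurableC; exact: measurable_usphere.
have N0 : Pr N = 0%E by exact: (uniform_on_sphere_setC (Ulaw i)).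
pose W w := (joint X w, joint U w).
have mW : measurable_fun setT (swap_polar i \o W).
  apply: (measurableT_comp (measurable_swap_polar i)).
  by apply: measurable_fun_pair; exact: measurable_joint.
apply: measure_eq_off_null N0 _ => //.
- by apply: measurableI => //; exact: (measurable_preimageT mW (measurable_minimizers M)).
- exact: measurableI.
move=> w /contrapT ui.
have eqW : nonzero X i w ->
    minimizers (swap_polar i (W w)).1 (swap_polar i (W w)).2 =
    flip_path i @^-1: argmin w.
  by move=> nz; apply: minimizers_swap_polar; rewrite tnth_mktuple.
split=> -[].
  by move=> nz e; split => //; apply: fK; rewrite -e; exact/esym/eqW.
move=> e nz; split => //; apply: (etrans (eqW nz)).
by rewrite [argmin w]e; apply/esym/fK.
Qed.

Variable C : Omega -> labelled_path n.
Hypothesis C_unif : uniform_minimizer X U C.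

Lemma path_flip_law i c :
  Pr (C @^-1` [set flip_path i c]) = Pr (C @^-1` [set c]).
Proof.
have [mC _ CM] := C_unif.
(* Conditioning on the set of minimizers: the weight of a path depends only on membership and
   cardinality, and both are compatible with the flip. *)
have Cdec c' : Pr (C @^-1` [set c']) =
    (\sum_(M : {set labelled_path n})
      ((if c' \in M then #|M|%:R^-1 else 0)%:E * Pr [set w | argmin w = M]))%E.
  rewrite (measure_finite_partition Pr (f := argmin))//; last first.
    by move=> M; exact: measurable_argmin.
  apply: eq_bigr => M _; rewrite setIC.
  have := CM M c' setT measurableT => /=.
  rewrite (_ : [set w | True /\ _] = [set w | argmin w = M]) //.
  by rewrite predeqE => w; split => [[]|].
have fI : injective (fun M : {set labelled_path n} => flip_path i @^-1: M).
  move=> M N /setP MN; apply/setP => c'.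
  by have := MN (flip_path i c'); rewrite !inE flip_pathK.
rewrite !Cdec (reindex_inj fI); apply: eq_bigr => M _.
rewrite -argmin_flip_law inE flip_pathK; congr ((if _ then _ else _)%:E * _)%E.
by rewrite on_card_preimset//; exists (flip_path i) => c' _; exact: flip_pathK.
Qed.

Definition labels_along (c : labelled_path n) : {ffun 'I_n -> bool} :=
  [ffun i => c.1 (c.2 i)].

Lemma labels_along_law (Q : pred {ffun 'I_n -> bool}) :
  Pr [set w | Q (labels_along (C w))] =
  (#|[set s | Q s]%SET|%:R / (2 ^ n)%:R)%:E.
Proof.
have [mC _ _] := C_unif.
have mL s : measurable ((labels_along \o C) @^-1` [set s]).
  rewrite (_ : _ @^-1` _ = \bigcup_(c in [set c | labels_along c = s]) C @^-1` [set c]).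
    by apply: fin_bigcup_measurable => [|c _]; [exact: finite_finset|exact: mC].
  rewrite predeqE => w; split => [h|[c /= h]]; first by exists (C w).
  by rewrite /= => ->.
pose rho s := Pr ((labels_along \o C) @^-1` [set s]).
have rhoE s : rho s = (\sum_c (if labels_along c == s then Pr (C @^-1` [set c]) else 0))%E.
  rewrite /rho (measure_finite_partition Pr (f := C))//.
  apply: eq_bigr => c _; case: eqP => cs.
    congr (Pr _); rewrite predeqE => w; split => [[]//|/= Cc].
    by split => //=; rewrite Cc.
  rewrite (_ : _ `&` _ = set0) ?measure0// -subset0 => w [/= + Cc].
  by rewrite Cc.
have rho_flip i s : rho (flip i s) = rho s.
  rewrite !rhoE.
  (* Flipping the label read at position [i] means flipping the observation visited there, which
     depends on the path. The flip law is applied path by path, and [phi] is an involution because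
     it keeps the permutation. *)
  pose phi (c : labelled_path n) := flip_path (c.2 i) c.
  have phiK : involutive phi by move=> [t p]; rewrite /phi /flip_path /= flipK.
  rewrite (reindex_inj (inv_inj phiK)); apply: eq_bigr => c _.
  rewrite path_flip_law; congr (if _ then _ else _).
  have -> : labels_along (phi c) = flip i (labels_along c).
    apply/ffunP => j; rewrite !ffunE; congr (_ (+) _).
    by rewrite (inj_eq perm_inj).
  by rewrite (inj_eq (inv_inj (@flipK n i))).
have rho_const s : rho s = ((2 ^ n)%:R^-1)%:E.
  have fr t : rho t \is a fin_num by exact: fin_num_measure.
  have : (\sum_t rho t = 1)%E.
    rewrite -(probability_setT Pr) (measure_finite_partition Pr (f := labels_along \o C))//.
    by apply: eq_bigr => t _; rewrite setTI.
  rewrite (eq_bigr (fun=> rho s)); last by move=> t _; exact: flip_invariant_const.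
  rewrite -(fineK (fr s)) sumEFin sumr_const => -[].
  rewrite card_ffun card_bool card_ord => e; congr (_%:E).
  have N0 : (2 ^ n)%:R != 0 :> R by rewrite pnatr_eq0 expn_eq0.
  by apply: (mulIf N0); rewrite mulr_natr e mulVf.
have mQ : measurable [set w | Q (labels_along (C w))].
  rewrite (_ : [set _ | _] = \bigcup_(s in [set s | Q s]) (labels_along \o C) @^-1` [set s]).
    by apply: fin_bigcup_measurable => [|c _]; [exact: finite_finset|exact: mL].
  rewrite predeqE => w; split => [h|[s /= Qs e]].
    by exists (labels_along (C w)).
  by move: Qs; rewrite -e.
rewrite (measure_finite_partition Pr (f := labels_along \o C))//.
rewrite (eq_bigr (fun s => (if Q s then (2 ^ n)%:R^-1 else 0)%:E)); last first.
  move=> s _; case: ifPn => [Qs|nQ].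
    rewrite -(rho_const s); congr (Pr _); rewrite predeqE => w; split => [[]//|/= e].
    by split => //=; rewrite e.
  rewrite (_ : _ `&` _ = set0) ?measure0// -subset0 => w [/= + e].
  by rewrite e (negbTE nQ).
rewrite sumEFin -big_mkcond sumr_const; congr (_%:E).
rewrite -[LHS]mulr_natl; congr (_%:R * _).
by apply: eq_card => s; rewrite inE.
Qed.

End label_law.

(** * Central limit theorem for weighted signs *)

Section normal_cdf.
Context {R : realType}.
Variable sigma : R.
Hypothesis sigma_gt0 : 0 < sigma.

Definition normal_cdf (z : R) : R :=
  (\int[lebesgue_measure]_(t in `]-oo, z]) normal_pdf 0 sigma t)%R.

Notation phi := (normal_pdf 0 sigma).

Lemma normal_cdfE z : normal_prob 0 sigma `]-oo, z] = (normal_cdf z)%:E.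
Proof.
apply/esym/fineK; apply: (fin_num_measure (normal_prob 0 sigma)).
exact: measurable_itv.
Qed.

Lemma is_derive_normal_cdf (z : R) : is_derive z 1 normal_cdf (phi z).
Proof.
have [] := @continuous_FTC1 R phi -oo%O z (z + 1) _ _ _ _.
- by rewrite ltrDl.
- apply: integrableS (integrable_normal_pdf 0 sigma) => //.
- by rewrite ltNyr.
- by apply: continuous_normal_pdf; rewrite gt_eqF.
move=> dF F'; split; first exact: dF.
by rewrite -derive1E.
Qed.

Lemma normal_cdf_ge0 z : 0 <= normal_cdf z.
Proof. by rewrite -lee_fin -normal_cdfE. Qed.

Lemma normal_cdf_le1 z : normal_cdf z <= 1.
Proof. by rewrite -lee_fin -normal_cdfE probability_le1. Qed.

Lemma normal_cdf_nondecreasing : nondecreasing_fun normal_cdf.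
Proof.
move=> x y xy; rewrite -lee_fin -!normal_cdfE.
by rewrite le_measure ?inE//; exact: subitvPr.
Qed.

Local Open Scope measure_display_scope.

(** Seen as a random variable under the normal law, the identity has [normal_cdf] as its
    distribution function, whence the limits at infinity. *)
Let idR : measurableTypeR R -> R := idfun.

#[local] HB.instance Definition _ :=
  @isMeasurableFun.Build _ _ _ _ idR (@measurable_id _ _ setT).

Lemma normal_cdf_cvgy : normal_cdf z @[z --> +oo] --> (1 : R).
Proof.
have := @cvg_cdfy1 _ _ R (normal_prob 0 sigma) (idR : {RV (normal_prob 0 sigma) >-> R}).
rewrite /cdf.
rewrite (_ : (fun r => _) = EFin \o normal_cdf).
  by move/fine_cvgP => [].
by apply/funext => z /=; rewrite -normal_cdfE.
Qed.

Lemma normal_cdf_cvgNy : normal_cdf z @[z --> -oo] --> (0 : R).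
Proof.
have := @cvg_cdfNy0 _ _ R (normal_prob 0 sigma) (idR : {RV (normal_prob 0 sigma) >-> R}).
rewrite /cdf.
rewrite (_ : (fun r => _) = EFin \o normal_cdf).
  by move/fine_cvgP => [].
by apply/funext => z /=; rewrite -normal_cdfE.
Qed.

End normal_cdf.

Section real_derivatives.
Context {R : realType}.
Implicit Types (f g df : R -> R) (x a b : R).

Lemma is_derive_add f g x a b : is_derive x 1 f a -> is_derive x 1 g b ->
  is_derive x 1 (fun y => f y + g y) (a + b).
Proof. by move=> fa gb; exact: is_deriveD. Qed.

Lemma is_derive_mul f g x a b : is_derive x 1 f a -> is_derive x 1 g b ->
  is_derive x 1 (fun y => f y * g y) (f x * b + g x * a).
Proof. by move=> fa gb; exact: is_deriveM. Qed.

Lemma is_derive_comp f g x a b : is_derive (g x) 1 f a -> is_derive x 1 g b ->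
  is_derive x 1 (fun y => f (g y)) (a * b).
Proof. by move=> fa gb; exact: is_derive1_comp. Qed.

Lemma is_derive_affine (c e x : R) : is_derive x 1 (fun y => c + e * y) e.
Proof.
have := is_derive_add (is_derive_cst c x 1)
  (is_derive_mul (is_derive_cst e x 1) (is_derive_id x 1)).
by rewrite add0r mulr1 mulr0 addr0.
Qed.

Lemma is_derive_sqr x : is_derive x 1 (fun y => y ^+ 2) (2 * x).
Proof.
by apply: is_derive_eq (is_derive_mul (is_derive_id x 1) (is_derive_id x 1)) _; ring.
Qed.

Lemma is_derive_csub (c : R) f x a : is_derive x 1 f a ->
  is_derive x 1 (fun y => c - f y) (- a).
Proof. by move=> fa; have := is_deriveB (is_derive_cst c x 1) fa; rewrite sub0r. Qed.

Lemma is_derive_within f df (a b : R) :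
  (forall x, x \in `[a, b] -> is_derive x 1 f (df x)) ->
  {within `[a, b], continuous f}.
Proof.
move=> fdf; apply: derivable_within_continuous => x xab.
by have [] := fdf x xab.
Qed.

Lemma MVT_is_derive f df (a b : R) : a <= b ->
  (forall x, x \in `[a, b] -> is_derive x 1 f (df x)) ->
  exists2 c, c \in `[a, b] & f b - f a = df c * (b - a).
Proof.
move=> ab fdf; have cf := is_derive_within fdf.
have fdfo x : x \in `]a, b[%R -> is_derive x 1 f (df x).
  by move=> xab; apply: fdf; exact: (subset_itv_oo_cc xab).
have [c cab e] := MVT_segment ab fdfo cf.
by exists c.
Qed.

Lemma derivative_bound_lipschitz f df (K : R) :
  (forall x, is_derive x 1 f (df x)) -> (forall x, `|df x| <= K) ->
  forall x y, `|f x - f y| <= K * `|x - y|.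
Proof.
move=> fdf dK; have main x y : x <= y -> `|f y - f x| <= K * `|y - x|.
  move=> xy; have [c _ ->] := MVT_is_derive xy (fun z _ => fdf z).
  by rewrite normrM ler_wpM2r.
move=> x y; have [xy|/ltW yx] := leP x y; last exact: main.
by rewrite distrC [X in K * X]distrC; exact: main.
Qed.

End real_derivatives.

(** * Derivatives of the normal density *)

Section normal_density_derivatives.
Context {R : realType}.
Variable sigma : R.
Hypothesis sigma_gt0 : 0 < sigma.
Notation phi := (normal_pdf 0 sigma).

Definition normal_pdf_deriv (z : R) : R := - (z / sigma ^+ 2) * phi z.
Notation chi := normal_pdf_deriv.

Let c : R := (sigma ^+ 2 *+ 2)^-1.

Let cE : (sigma ^+ 2)^-1 = 2 * c.
Proof. by rewrite /c; field; rewrite gt_eqF. Qed.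

Let c_gt0 : 0 < c.
Proof. by rewrite invr_gt0 mulrn_wgt0// exprn_gt0. Qed.

Let phiE z : phi z = normal_peak sigma * expR (- c * z ^+ 2).
Proof.
rewrite normal_pdfE ?gt_eqF// /normal_fun subr0; congr (_ * expR _).
by rewrite /c; ring.
Qed.

Lemma is_derive_normal_pdf (z : R) : is_derive z 1 phi (chi z).
Proof.
rewrite (_ : phi = fun z => normal_peak sigma * expR (- c * z ^+ 2)); last first.
  by apply/funext => y; exact: phiE.
have de := is_derive_mul (is_derive_cst (- c) z 1) (is_derive_sqr z).
apply: is_derive_eq (is_derive_mul (is_derive_cst (normal_peak sigma) z 1)
  (is_derive_comp (is_derive_expR _) de)) _.
by rewrite /chi phiE cE /cst; ring.
Qed.

Lemma is_derive_normal_pdf_deriv (z : R) :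
  is_derive z 1 chi ((4 * c ^+ 2 * z ^+ 2 - 2 * c) * phi z).
Proof.
rewrite (_ : chi = fun z => (0 + - (2 * c) * z) * phi z); last first.
  by apply/funext => y; rewrite /chi cE; congr (_ * _); ring.
apply: is_derive_eq (is_derive_mul (is_derive_affine _ _ z) (is_derive_normal_pdf z)) _.
by rewrite /chi cE; ring.
Qed.

(** This bounds the third derivative of the distribution function, which controls the cubic error of
    a replacement step. *)
Lemma normal_pdf_deriv_lipschitz : exists2 K : R, 0 <= K &
  forall x y, `|chi x - chi y| <= K * `|x - y|.
Proof.
have k0 := normal_peak_ge0 sigma.
(* 6 = 4 + 2: the second derivative of the density is 4 c (c z^2) - 2 c times the density, and both
   exp(-t) and t exp(-t) are at most 1 for t = c z^2, by 1 + t <= exp t. *)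
exists (6 * c * normal_peak sigma).
  by rewrite mulr_ge0// mulr_ge0// ltW.
apply: (derivative_bound_lipschitz is_derive_normal_pdf_deriv) => z.
rewrite phiE.
set e := expR _.
have e0 : 0 <= e by exact: expR_ge0.
have t0 : 0 <= c * z ^+ 2 by rewrite mulr_ge0 ?sqr_ge0// ltW.
have te : (1 + c * z ^+ 2) * e <= 1.
  rewrite /e mulNr expRN -ler_pdivlMr ?invr_gt0 ?expR_gt0// invrK mul1r.
  exact: expR_ge1Dx.
have ck0 : 0 <= c * normal_peak sigma := mulr_ge0 (ltW c_gt0) k0.
have ke0 := mulr_ge0 ck0 e0.
have kz0 := mulr_ge0 ck0 (mulr_ge0 t0 e0).
have b1 : c * normal_peak sigma * (c * z ^+ 2 * e) <= c * normal_peak sigma.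
  rewrite -[leRHS]mulr1 ler_wpM2l//; lra.
have b2 : c * normal_peak sigma * e <= c * normal_peak sigma.
  rewrite -[leRHS]mulr1 ler_wpM2l//.
  have : 0 <= c * z ^+ 2 * e by rewrite mulr_ge0.
  lra.
rewrite ler_norml; apply/andP; split.
  have -> : (4 * c ^+ 2 * z ^+ 2 - 2 * c) * (normal_peak sigma * e) =
    4 * (c * normal_peak sigma * (c * z ^+ 2 * e)) - 2 * (c * normal_peak sigma * e) by ring.
  lra.
have -> : (4 * c ^+ 2 * z ^+ 2 - 2 * c) * (normal_peak sigma * e) =
  4 * (c * normal_peak sigma * (c * z ^+ 2 * e)) - 2 * (c * normal_peak sigma * e) by ring.
lra.
Qed.

End normal_density_derivatives.

(** * One replacement step along the heat flow *)

Section heat_step.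
Context {R : realType}.
Variables (sigma x : R).
Hypothesis sigma_gt0 : 0 < sigma.
Notation Psi := (normal_cdf sigma).
Notation psi := (normal_pdf 0 sigma).
Notation chi := (normal_pdf_deriv sigma).

(* The probability that [sigma * y] plus a centered normal variable of variance
   [sigma ^ 2 * t] is at most [x]; it solves the heat equation u_t = u_yy / 2. *)
Definition heat (t y : R) : R := Psi ((x - sigma * y) / Num.sqrt t).

(** [Z] is the argument of [Psi] in [heat] when the variance drops by tau^2 while the point moves by
    e * tau, with e = 1 or -1. *)
Let D (t tau : R) := Num.sqrt (t - tau ^+ 2).
Let Z (t y e tau : R) := (x - sigma * (y + e * tau)) / D t tau.

Let is_derive_Z (t y e tau : R) : tau ^+ 2 < t ->
  is_derive tau 1 (fun s => Psi (Z t y e s))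
    (psi (Z t y e tau) * (- (sigma * e) / D t tau + Z t y e tau * tau / D t tau ^+ 2)).
Proof.
move=> taut; have t0 : 0 < t - tau ^+ 2 by rewrite subr_gt0.
have D0 : 0 < D t tau by rewrite sqrtr_gt0.
have dt : is_derive tau 1 (fun s => t - s ^+ 2) (- (2 * tau)).
  exact: is_derive_csub (is_derive_sqr tau).
have dD := is_derive_comp (g := fun s => t - s ^+ 2) (is_derive1_sqrt t0) dt.
have DN0 : D t tau != 0 by rewrite gt_eqF.
have dDV := is_deriveV (f := D t) DN0 dD.
have dN : is_derive tau 1 (fun s => x - sigma * (y + e * s)) (- (sigma * e)).
  apply: is_derive_csub; apply: is_derive_eq (is_derive_mul
    (is_derive_cst sigma tau 1) (is_derive_affine y e tau)) _.
  by rewrite mulr0 addr0.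
have dZ := is_derive_mul dN dDV.
apply: is_derive_eq (is_derive_comp (g := Z t y e)
  (is_derive_normal_cdf sigma_gt0 _) dZ) _.
congr (_ * _).
rewrite -/(D t tau) /Z /GRing.scale /=.
by field.
Qed.

Let half_deriv (t y tau : R) : R := 2^-1 *
  (psi (Z t y 1 tau) * (- (sigma * 1) / D t tau + Z t y 1 tau * tau / D t tau ^+ 2) +
   psi (Z t y (-1) tau) *
     (- (sigma * -1) / D t tau + Z t y (-1) tau * tau / D t tau ^+ 2)).

(* The heat equation cancels the leading terms: the difference of [psi] at [zp] and
   [zm] is [chi] at an intermediate point times [zm - zp]. *)
Let half_deriv_bound (K t y tau : R) : 0 <= tau -> tau ^+ 2 < t ->
  (forall a b, `|chi a - chi b| <= K * `|a - b|) ->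
  `|half_deriv t y tau| <= K * sigma ^+ 3 * tau ^+ 2 / D t tau ^+ 3.
Proof.
move=> tau0 taut Klip; have t0 : 0 < t - tau ^+ 2 by rewrite subr_gt0.
have D0 : 0 < D t tau by rewrite sqrtr_gt0.
have DN0 : D t tau != 0 by rewrite gt_eqF.
have sN0 : sigma != 0 by rewrite gt_eqF.
set zp := Z t y 1 tau; set zm := Z t y (-1) tau.
have zmp : zm - zp = 2 * sigma * tau / D t tau by rewrite /zm /zp /Z; field.
have zpm : zp <= zm.
  by rewrite -subr_ge0 zmp divr_ge0 ?(ltW D0)// !mulr_ge0// ltW.
have [xi xiz mvt] := MVT_is_derive zpm (fun z _ => is_derive_normal_pdf sigma_gt0 z).
have chiE z : z * psi z = - sigma ^+ 2 * chi z by rewrite /normal_pdf_deriv; field.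
have -> : half_deriv t y tau = sigma ^+ 2 * tau / (2 * D t tau ^+ 2) *
    ((chi xi - chi zp) + (chi xi - chi zm)).
  rewrite /half_deriv -/zp -/zm.
  have -> : psi zp * (- (sigma * 1) / D t tau + zp * tau / D t tau ^+ 2) +
      psi zm * (- (sigma * -1) / D t tau + zm * tau / D t tau ^+ 2) =
      sigma / D t tau * (psi zm - psi zp) +
      tau / D t tau ^+ 2 * (zp * psi zp + zm * psi zm) by ring.
  rewrite mvt zmp !chiE; field; exact: DN0.
have c0 : 0 <= sigma ^+ 2 * tau / (2 * D t tau ^+ 2).
  by apply: divr_ge0; apply: mulr_ge0 => //; exact: sqr_ge0.
rewrite normrM (ger0_norm c0).
have -> : K * sigma ^+ 3 * tau ^+ 2 / D t tau ^+ 3 =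
    sigma ^+ 2 * tau / (2 * D t tau ^+ 2) * (K * (zm - zp)).
  by rewrite zmp; field.
rewrite ler_wpM2l//; apply: le_trans (ler_normD _ _) _.
have /andP[x1 x2] : zp <= xi <= zm by move: xiz; rewrite in_itv.
apply: le_trans (lerD (Klip _ _) (Klip _ _)) _.
rewrite [`|xi - zp|]ger0_norm ?subr_ge0// [`|xi - zm|]ler0_norm ?subr_le0//.
by rewrite -mulrDr le_eqVlt; apply/orP; left; apply/eqP; congr (_ * _); ring.
Qed.

(** A normal variable of variance b^2 is replaced by a sign times [b]. Let the size [s] of the jump
    grow from 0 to [b]: at s = 0 the average over the two signs is [heat t y], and its derivative in
    [s] is of order s^2, so the mean value theorem gives an error of order b^3. The lower bound
    [delta] on the remaining standard deviation keeps the constant finite. *)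
Lemma heat_step (K delta t y b : R) : 0 <= K ->
  (forall a b, `|chi a - chi b| <= K * `|a - b|) ->
  0 < delta -> delta ^+ 2 <= t - b ^+ 2 ->
  `|2^-1 * (heat (t - b ^+ 2) (y + b) + heat (t - b ^+ 2) (y - b)) - heat t y| <=
  K * sigma ^+ 3 / delta ^+ 3 * `|b| ^+ 3.
Proof.
move=> K0 Klip d0.
wlog b0 : b / 0 <= b => [wlog|].
  have [/wlog//|/ltW b0] := leP 0 b.
  have := wlog (- b); rewrite oppr_ge0 sqrrN normrN opprK => /(_ b0).
  by rewrite [heat _ (y - b) + _]addrC.
move=> dtb; rewrite [`|b|]ger0_norm//.
pose w s := 2^-1 * (Psi (Z t y 1 s) + Psi (Z t y (-1) s)).
have D_ge s : 0 <= s <= b -> s ^+ 2 < t /\ delta <= D t s.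
  move=> /andP[s0 sb].
  have sb2 : s ^+ 2 <= b ^+ 2 by rewrite ler_pXn2r ?nnegrE.
  have dts : delta ^+ 2 <= t - s ^+ 2 by lra.
  split; first by have := exprn_gt0 2 d0; lra.
  by rewrite -[delta]ger0_norm ?(ltW d0)// -sqrtr_sqr ler_wsqrtr.
have dw s : s \in `[0, b] -> is_derive s 1 w (half_deriv t y s).
  rewrite in_itv => /= /D_ge[st _].
  have := is_derive_mul (is_derive_cst (2^-1 : R) s 1)
    (is_derive_add (is_derive_Z y 1 st) (is_derive_Z y (-1) st)).
  by rewrite mulr0 addr0.
have [s sb e] := MVT_is_derive b0 dw.
have -> : 2^-1 * (heat (t - b ^+ 2) (y + b) + heat (t - b ^+ 2) (y - b)) = w b.
  by rewrite /w /Z /heat mul1r mulN1r.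
have half (q : R) : q = 2^-1 * (q + q) by lra.
have -> : heat t y = w 0.
  by rewrite /w /Z /heat /D !mulr0 addr0 expr0n subr0 -half.
rewrite e subr0 normrM (ger0_norm b0).
move: sb; rewrite in_itv /= => sb; have [st dD] := D_ge s sb.
have /andP[s0 sleb] := sb.
have -> : K * sigma ^+ 3 / delta ^+ 3 * b ^+ 3 = K * sigma ^+ 3 * b ^+ 2 / delta ^+ 3 * b.
  by field; rewrite gt_eqF.
rewrite ler_wpM2r//; apply: le_trans (half_deriv_bound y s0 st Klip) _.
have D0 : 0 < D t s by exact: lt_le_trans dD.
have ks0 : 0 <= K * sigma ^+ 3 := mulr_ge0 K0 (exprn_ge0 3 (ltW sigma_gt0)).
apply: ler_pM.
- exact: mulr_ge0 ks0 (sqr_ge0 s).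
- by rewrite invr_ge0 exprn_ge0// ltW.
- by rewrite ler_wpM2l// ler_pXn2r ?nnegrE.
- rewrite lef_pV2 ?posrE ?exprn_gt0//.
  by rewrite ler_pXn2r ?nnegrE// ltW.
Qed.

End heat_step.

Section lindeberg.
Context {R : realType}.
Variables (sigma x delta K : R).
Hypotheses (sigma_gt0 : 0 < sigma) (delta_gt0 : 0 < delta) (K_ge0 : 0 <= K).
Hypothesis K_lip : forall a b,
  `|normal_pdf_deriv sigma a - normal_pdf_deriv sigma b| <= K * `|a - b|.
Variables (n : nat) (b : 'I_n -> R).

Definition rademacher (s : {ffun 'I_n -> bool}) (i : 'I_n) : R := (s i)%:R *+ 2 - 1.

Let S (k : nat) s : R := \sum_(i < n | (i < k)%N) rademacher s i * b i.
Let T (k : nat) : R := delta ^+ 2 + \sum_(i < n | (k <= i)%N) b i ^+ 2.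
(* In [A k] the first [k] signs are kept and the others are replaced by normal
   variables of the same variance; the term [delta ^ 2] is the smoothing. *)
Let A (k : nat) : R := \sum_(s : {ffun 'I_n -> bool}) heat sigma x (T k) (S k s).
Let C : R := K * sigma ^+ 3 / delta ^+ 3.

Let TS (i : 'I_n) : T i = T i.+1 + b i ^+ 2.
Proof.
rewrite /T (bigD1 i)//= -addrA; congr (_ + _); rewrite addrC; congr (_ + _).
apply: eq_bigl => j; rewrite ltn_neqAle andbC; congr (_ && _).
by rewrite eq_sym.
Qed.

Let T_ge k : delta ^+ 2 <= T k.
Proof. by rewrite lerDl; apply: sumr_ge0 => i _; exact: sqr_ge0. Qed.

Let SS (i : 'I_n) s : S i.+1 s = S i s + rademacher s i * b i.
Proof.
rewrite /S (bigD1 i)//= addrC; congr (_ + _).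
by apply: eq_bigl => j; rewrite ltnS [RHS]ltn_neqAle andbC.
Qed.

Let S_flip (i : 'I_n) s : S i (flip i s) = S i s.
Proof.
apply: eq_bigr => j ji; rewrite /rademacher ffunE.
by rewrite (_ : (j == i) = false)//; apply: contraTF ji => /eqP ->; rewrite ltnn.
Qed.

Let A_step (i : 'I_n) : `|A i.+1 - A i| <= (2 ^ n)%:R * (C * `|b i| ^+ 3).
Proof.
pose F s := heat sigma x (T i.+1) (S i.+1 s).
(* Pairing each [s] with its flip at [i] produces the two jumps of [heat_step], since [S i] does not
   see the i-th sign. *)
have AE : A i.+1 = \sum_s 2^-1 * (F s + F (flip i s)).
  have FE : \sum_s F (flip i s) = A i.+1.
    by rewrite /A [RHS](reindex_inj (inv_inj (@flipK n i))).
  have AF : \sum_s F s = A i.+1 by [].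
  by rewrite -mulr_sumr big_split /= FE AF; lra.
rewrite AE -sumrB; apply: le_trans (ler_norm_sum _ _ _) _.
have -> : (2 ^ n)%:R * (C * `|b i| ^+ 3) =
    \sum_(s : {ffun 'I_n -> bool}) C * `|b i| ^+ 3.
  by rewrite sumr_const card_ffun card_bool card_ord mulr_natl.
apply: ler_sum => s _.
have dT : delta ^+ 2 <= T i - b i ^+ 2 by rewrite TS addrK.
have := heat_step x sigma_gt0 (S i s) K_ge0 K_lip delta_gt0 dT.
have -> : T i - b i ^+ 2 = T i.+1 by rewrite TS addrK.
rewrite /F !SS S_flip /rademacher ffunE eqxx; case: (s i) => /=.
  have -> : ((1 *+ 2 - 1) * b i : R) = b i by ring.
  by have -> : ((0 *+ 2 - 1) * b i : R) = - b i by ring.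
rewrite [heat _ _ _ _ + _]addrC.
have -> : ((1 *+ 2 - 1) * b i : R) = b i by ring.
by have -> : ((0 *+ 2 - 1) * b i : R) = - b i by ring.
Qed.

(** Telescoping of [A] from 0, where everything is normal, to [n], where only the smoothing noise
    is; the factor 2^n turns sums over sign vectors into expectations. *)
Lemma lindeberg_rademacher :
  `|(\sum_(s : {ffun 'I_n -> bool})
      normal_cdf sigma ((x - sigma * \sum_i rademacher s i * b i) / delta)) / (2 ^ n)%:R -
    normal_cdf sigma (x / Num.sqrt (delta ^+ 2 + \sum_i b i ^+ 2))| <=
  C * \sum_i `|b i| ^+ 3.
Proof.
have A0 : A 0 = normal_cdf sigma (x / Num.sqrt (delta ^+ 2 + \sum_i b i ^+ 2)) * (2 ^ n)%:R.
  rewrite /A (eq_bigr (fun=> heat sigma x (T 0) 0)); last first.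
    by move=> s _; rewrite /S big_pred0.
  rewrite sumr_const card_ffun card_bool card_ord -[LHS]mulr_natr /heat.
  by rewrite mulr0 subr0 /T.
have An : A n = \sum_(s : {ffun 'I_n -> bool})
    normal_cdf sigma ((x - sigma * \sum_i rademacher s i * b i) / delta).
  apply: eq_bigr => s _; rewrite /heat /T big_pred0; last first.
    by move=> i; rewrite leqNgt ltn_ord.
  have Sn : S n s = \sum_i rademacher s i * b i.
    by apply: eq_bigl => i; rewrite ltn_ord.
  by rewrite addr0 sqrtr_sqr (gtr0_norm delta_gt0) Sn.
have N0 : 0 < (2 ^ n)%:R :> R by rewrite ltr0n expn_gt0.
have tele k : (k <= n)%N -> `|A k - A 0| <=
    (2 ^ n)%:R * \sum_(i < n | (i < k)%N) C * `|b i| ^+ 3.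
  elim: k => [_|k IH kn]; first by rewrite subrr normr0 big_pred0 ?mulr0.
  pose i := Ordinal kn.
  rewrite -[A k.+1 - A 0](subrKA (A k)).
  apply: le_trans (ler_normD _ _) _.
  rewrite (bigD1 i)//= mulrDr; apply: lerD; first exact: (A_step i).
  rewrite (eq_bigl (fun j : 'I_n => (j < k)%N)); first exact: IH (ltnW kn).
  by move=> j; rewrite ltnS [RHS]ltn_neqAle andbC.
have := tele n (leqnn n); rewrite An A0 => h.
rewrite -[X in _ - X](mulfK (lt0r_neq0 N0)) -mulrBl normrM normfV (gtr0_norm N0).
rewrite ler_pdivrMr//; apply: le_trans h _.
rewrite mulrC ler_pM2r// mulr_sumr.
by rewrite le_eqVlt; apply/orP; left; apply/eqP; apply: eq_bigl => i; rewrite ltn_ord.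
Qed.

End lindeberg.

(** * From smoothed indicators to distribution functions *)

Section rademacher_clt.
Context {R : realType}.
Variable sigma : R.
Hypothesis sigma_gt0 : 0 < sigma.
Notation Psi := (normal_cdf sigma).

Lemma normal_cdf_tails (e : R) : 0 < e ->
  exists2 k : R, 0 < k & 1 - e <= Psi k /\ Psi (- k) <= e.
Proof.
move=> e0; have mono := normal_cdf_nondecreasing sigma.
have [k1 /ltW h1] : exists k1, 1 - e < Psi k1.
  apply: (filter_ex (cvgr_gt (1 : R) (normal_cdf_cvgy sigma) (1 - e) _)).
  by rewrite gtrBl.
have [k2 /ltW h2] : exists k2, Psi k2 < e.
  exact: (filter_ex (cvgr_lt (0 : R) (normal_cdf_cvgNy sigma) e e0)).
exists (1 + `|k1| + `|k2|); first by rewrite !ltr_wpDr.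
have := ler_norm k1; have := ler_norm (- k2); rewrite normrN => a1 a2.
split.
  apply: le_trans h1 _; apply: mono; have := normr_ge0 k2; lra.
apply: le_trans h2; apply: mono; have := normr_ge0 k1; lra.
Qed.

(** With weights of unit sum of squares, the fully normal end of the replacement has variance
    sigma^2 (delta^2 + 1); the shift k * delta pays for smoothing the indicator. *)
Lemma smoothed_normal_cdf_cvg (x k : R) :
  Psi ((x + k * delta) / Num.sqrt (delta ^+ 2 + 1)) @[delta --> 0^'+] --> Psi x.
Proof.
have dPsi : {for x, continuous Psi}.
  apply: differentiable_continuous; apply/derivable1_diffP.
  by have [] := is_derive_normal_cdf sigma_gt0 x.
apply: cvg_at_right_filter.
suff h : (x + k * delta) / Num.sqrt (delta ^+ 2 + 1) @[delta --> 0] --> x.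
  exact: (cvg_comp _ _ h dPsi).
rewrite -[X in _ --> X](_ : (x + k * 0) / Num.sqrt (0 ^+ 2 + 1) = x); last first.
  by rewrite mulr0 addr0 expr0n add0r sqrtr1 divr1.
apply: cvgM.
  by apply: cvgD; [exact: cvg_cst|apply: cvgM; [exact: cvg_cst|exact: cvg_id]].
apply: cvgV; first by rewrite expr0n add0r sqrtr1 oner_neq0.
apply: (cvg_comp (fun d : R => d ^+ 2 + 1) Num.sqrt); last exact: sqrt_continuous.
by apply: cvgD; [apply: exprn_continuous|exact: cvg_cst].
Qed.

Lemma rademacher_clt (x eta : R) : 0 < eta -> exists2 M : R, 0 < M &
  forall n (b : 'I_n -> R), \sum_i b i ^+ 2 = 1 -> (forall i, `|b i| <= M) ->
  `|#|[set s | sigma * \sum_i rademacher s i * b i <= x]%SET|%:R / (2 ^ n)%:R - Psi x| <= eta.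
Proof.
(* Three errors of at most [e] will add up: smoothing of the indicator, replacement of the signs,
   and removal of [delta]. *)
move=> eta0; pose e := eta / 4; have e0 : 0 < e by rewrite divr_gt0.
have [k k0 [hk hNk]] := normal_cdf_tails e0.
have [K K0 Klip] := normal_pdf_deriv_lipschitz sigma_gt0.
have [delta [d0 [dp dm]]] : exists delta : R, 0 < delta /\
    (`|Psi x - Psi ((x + k * delta) / Num.sqrt (delta ^+ 2 + 1))| < e /\
     `|Psi x - Psi ((x + - k * delta) / Num.sqrt (delta ^+ 2 + 1))| < e).
  have near_lt k' : \forall d \near (0 : R)^'+,
      `|Psi x - Psi ((x + k' * d) / Num.sqrt (d ^+ 2 + 1))| < e.
    have /cvgrPdist_lt := @smoothed_normal_cdf_cvg x k'.
    exact.
  apply: (@filter_ex _ ((0 : R)^'+)).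
  near=> d; split; first by near: d; exact: nbhs_right_gt.
  by split; near: d; exact: near_lt.
pose C := K * sigma ^+ 3 / delta ^+ 3.
have C0 : 0 <= C.
  by apply: divr_ge0; [apply: mulr_ge0 => //|]; rewrite exprn_ge0// ltW.
have C10 : 0 < C + 1 by rewrite ltr_wpDl.
(* If all |b_i| <= M, the sum of |b_i|^3 is at most M, so the replacement error is at most C M <= e;
   adding 1 covers C = 0. *)
exists (e / (C + 1)); first by rewrite divr_gt0.
move=> n b b1 bM.
have cube : C * \sum_i `|b i| ^+ 3 <= e.
  have : \sum_i `|b i| ^+ 3 <= e / (C + 1).
    move: bM; set M := e / (C + 1) => bM.
    rewrite -[leRHS]mulr1 -b1 mulr_sumr; apply: ler_sum => i _.
    by rewrite exprS real_normK ?num_real// ler_wpM2r ?sqr_ge0.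
  move=> /(ler_wpM2l C0)/le_trans; apply.
  by rewrite mulrCA ger_pMr// ler_pdivrMr// mul1r lerDl.
have N0 : 0 < (2 ^ n)%:R :> R by rewrite ltr0n expn_gt0.
pose W s := sigma * \sum_i rademacher s i * b i.
have lin y := lindeberg_rademacher y sigma_gt0 d0 K0 Klip b.
have card_sum : #|[set s | W s <= x]%SET|%:R =
    \sum_(s : {ffun 'I_n -> bool}) (W s <= x)%R%:R :> R.
  by rewrite -sum1_card natr_sum big_mkcond; apply: eq_bigr => s _; rewrite inE; case: ifP.
have cardN (y : R) : \sum_(s : {ffun 'I_n -> bool}) y = y * (2 ^ n)%:R.
  by rewrite sumr_const card_ffun card_bool card_ord mulr_natr.
(* The indicator of W <= x is squeezed between smoothed ones shifted by k * delta: if W <= x the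
   upper argument is at least [k], and if W > x the lower one is at most [- k], where [Psi] is
   within [e] of 1 and of 0. *)
have up : #|[set s | W s <= x]%SET|%:R / (2 ^ n)%:R <=
    (\sum_s Psi ((x + k * delta - W s) / delta)) / (2 ^ n)%:R + e.
  rewrite ler_pdivrMr// mulrDl divfK ?gt_eqF// -cardN -big_split card_sum.
  apply: ler_sum => s _ /=; have [Wx|Wx] := leP (W s) x; last first.
    by rewrite addr_ge0 ?normal_cdf_ge0// ltW.
  rewrite -lerBlDr; apply: le_trans hk _; apply: normal_cdf_nondecreasing.
  by rewrite ler_pdivlMr//; lra.
have lo : (\sum_s Psi ((x + - k * delta - W s) / delta)) / (2 ^ n)%:R - e <=
    #|[set s | W s <= x]%SET|%:R / (2 ^ n)%:R.
  rewrite lerBlDr ler_pdivrMr// mulrDl divfK ?gt_eqF// -cardN card_sum -big_split.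
  apply: ler_sum => s _ /=; have [Wx|Wx] := leP (W s) x.
    by rewrite (le_trans (normal_cdf_le1 _ _))// lerDl ltW.
  rewrite add0r; apply: le_trans hNk; apply: normal_cdf_nondecreasing.
  by rewrite ler_pdivrMr//; lra.
have := lin (x + k * delta); have := lin (x + - k * delta); rewrite b1 -/C.
move=> /le_trans/(_ cube); rewrite ler_norml => /andP[l1 l2].
move=> /le_trans/(_ cube); rewrite ler_norml => /andP[l3 l4].
move: dp dm; rewrite !ltr_norml => /andP[d1 d2] /andP[d3 d4].
have e4 : eta = 4 * e by rewrite /e; field.
by rewrite ler_norml -/W; apply/andP; split; rewrite e4; lra.
Unshelve. all: by end_near. Qed.

End rademacher_clt.

(** A label is (1 + sign) / 2, so centring leaves half a weighted sum of signs; this half is the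
    standard deviation of the limit. *)
Lemma linear_rank_statistic_labels (R : realType) n (a : 'I_n -> R)
    (c : labelled_path n) (v : R) :
  (linear_rank_statistic a c - 2^-1 * \sum_i a i) / v =
  2^-1 * \sum_i rademacher (labels_along c) i * (a i / v).
Proof.
rewrite /linear_rank_statistic !mulr_sumr -sumrB mulr_suml.
by apply: eq_bigr => i _; rewrite /rademacher ffunE; move: (v^-1) => w; field.
Qed.

Theorem theorem3p3 (R : realType)
  (* sample sizes and dimensions, tending to infinity at arbitrary rates *)
  (n d : nat -> nat)
  (hn2 : forall k, (2 <= n k)%N) (hd2 : forall k, (2 <= d k)%N)
  (hn : n @ \oo --> \oo) (hd : d @ \oo --> \oo)
  (* the law P, which may depend on the dimension *)
  (P : forall m : nat, probability (m.-tuple R) R)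
  (hP : forall m : nat, (2 <= m)%N -> spherically_symmetric (P m))
  (* the scores a(1), ..., a(m) for sample size m *)
  (a : forall m : nat, 'I_m -> R)
  (ha_sum : (\sum_(i < m) a m i ^+ 2) @[m --> \oo] --> +oo)
  (ha_max : (\big[Num.max/0]_(i < m)
               (a m i ^+ 2 / \sum_(j < m) a m j ^+ 2)) @[m --> \oo] --> 0)
  (disp : nat -> measure_display) (Omega : forall k, measurableType (disp k))
  (Pr : forall k, probability (Omega k) R)
  (X U : forall k, 'I_(n k) -> {RV (Pr k) >-> (d k).-tuple R})
  (hXlaw : forall k i, has_law (X k i) (P (d k)))
  (hXind : forall k, mutually_independent (X k))
  (hUlaw : forall k i, uniform_on_sphere (distribution (Pr k) (U k i)))
  (hUind : forall k, mutually_independent (U k))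
  (hXU : forall k, independent_families (X k) (U k))
  (* the pair (S, Pi) *)
  (C : forall k, Omega k -> labelled_path (n k))
  (hC : forall k, uniform_minimizer (X k) (U k) (C k)) :
  cvg_in_distribution Pr
    (fun k w =>
       (linear_rank_statistic (a (n k)) (C k w)
          - 2^-1 * \sum_(i < n k) a (n k) i)
       / Num.sqrt (\sum_(i < n k) a (n k) i ^+ 2))
    (normal_prob 0 (Num.sqrt 4^-1)).
Proof.
have half : Num.sqrt (4^-1 : R) = 2^-1.
  by rewrite (_ : 4^-1 = (2^-1 : R) ^+ 2) ?sqrtr_sqr ?gtr0_norm//; field.
have half_gt0 : 0 < (2^-1 : R) by [].
move=> x _; rewrite half normal_cdfE.
pose V k := \sum_(i < n k) a (n k) i ^+ 2.
pose b k i := a (n k) i / Num.sqrt (V k).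
pose r k : R := #|[set s | (2^-1 * \sum_i rademacher s i * b k i <= x)%R]%SET|%:R
  / (2 ^ n k)%:R.
have PrE k : Pr k [set w | (linear_rank_statistic (a (n k)) (C k w)
    - 2^-1 * \sum_(i < n k) a (n k) i)
    / Num.sqrt (\sum_(i < n k) a (n k) i ^+ 2) <= x] = (r k)%:E.
  rewrite -(labels_along_law (hP _ (hd2 k)) (hXlaw k) (hXind k) (hUlaw k) (hUind k)
    (hXU k) (hC k) (fun s => 2^-1 * \sum_i rademacher s i * b k i <= x)).
  by congr (Pr k _); rewrite predeqE => w /=; rewrite linear_rank_statistic_labels.
under eq_fun do rewrite PrE.
apply: cvg_EFin; first by near=> k.
apply/cvgrPdist_le => eta eta0.
have [M M0 clt] := rademacher_clt half_gt0 x eta0.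
(* Where V k = 0 the weights [b k] are all 0, by division by 0; their squares sum to 1 only from
   some [k] on. *)
have nV : \forall k \near \oo, 0 < V k.
  have := hn _ (cvgry_gt ha_sum 0); exact.
have nM : \forall k \near \oo, \big[Num.max/0]_(i < n k)
    (a (n k) i ^+ 2 / \sum_(j < n k) a (n k) j ^+ 2) < M ^+ 2.
  have M20 : 0 < M ^+ 2 by rewrite exprn_gt0.
  exact: (hn _ (cvgr_lt 0 ha_max (M ^+ 2) M20)).
near=> k.
have Vk : 0 < V k by near: k.
have sqV : Num.sqrt (V k) ^+ 2 = V k by rewrite sqr_sqrtr// ltW.
rewrite distrC; apply: clt.
  under eq_bigr do rewrite expr_div_n sqV.
  by rewrite -mulr_suml divff// gt_eqF.
move=> i; rewrite -(ler_pXn2r (ltn0Sn 1)) ?nnegrE ?(ltW M0)//.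
rewrite real_normK ?num_real// /b expr_div_n sqV.
have Mk : \big[Num.max/0]_(i < n k)
    (a (n k) i ^+ 2 / \sum_(j < n k) a (n k) j ^+ 2) < M ^+ 2 by near: k.
by apply: le_trans (ltW Mk); rewrite (bigD1 i)//= le_max lexx.
Unshelve. all: by end_near. Qed.
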